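(* Let $m \geq 6$ be an integer and let $r \geq 2$ be the number of distinct prime divisors of $m$. Fix $h \in \mathbb{N}$ and functions $k_1,\dots,k_h\colon \mathbb{N}\to\mathbb{N}$ with $\prod_{i\in[h]} k_i(n) = n$ for all $n$, and assume $k_i(n) > 8$ for every $i\in[h]$ and all sufficiently large $n$. Let $k_{\max}(n) = \max_{i\in[h]} k_i(n)$. (i) Every $\mathbf{Aut}(\mathcal{T}_n^{\boldsymbol{k}})$-symmetric $\mathrm{MOD}_m$-circuit computing $\mathrm{AND}_n$ has size at least $2^{\Omega(k_{\max}(n)^{1/r}\cdot \log k_{\max}(n))}$. (ii) There exist $\mathrm{MOD}_m$-circuits of depth $2h$ computing $\mathrm{AND}_n$ of size $2^{O(k_{\max}(n)^{1/r}\cdot \log k_{\max}(n))}$.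
   Context: For $R \subseteq \mathbb{Z}_m$, the gate $\mathrm{MOD}_m^R$ has arbitrary fan-in and on Boolean inputs $y_1,\dots,y_k$ outputs $1$ iff $(\sum_i y_i \bmod m) \in R$. A $\mathrm{MOD}_m$-circuit on variables $x_1,\dots,x_n$ is a finite directed acyclic graph (multiple wires allowed) with a single designated output gate; the gates without incoming wires are input gates, each labelled by a variable, exactly one per variable; every other gate is labelled $\mathrm{MOD}_m^R$ for some $R$ (may differ between gates) and computes that operation on the values of its children counted with wire multiplicity. Size = number of gates plus number of wires with multiplicity; depth = maximum number of wires on a path from the output to an input gate. $\mathrm{AND}_n$ is $n$-ary conjunction. For $\Gamma\le\mathbf{Sym}_n$, a circuit is $\Gamma$-symmetric if every $\pi\in\Gamma$ extends to a circuit automorphism (bijection of gates preserving internal gate labels and wire multiplicities) mapping the input gate of $x_i$ to that of $x_{\pi(i)}$. $\mathcal{T}_n^{\boldsymbol{k}}$ is the rooted tree with levels $0,\dots,h$, the root alone on level $h$, every node on level $i\in[h]$ having exactly $k_i(n)$ children; its $n$ leaves (level $0$) are identified with $[n]$, i.e. with the variables $x_1,\dots,x_n$. $\mathbf{Aut}(\mathcal{T}_n^{\boldsymbol{k}})$ is its automorphism group, viewed as a subgroup of $\mathbf{Sym}_n$ via its action on the leaves. *)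

(* Defs.v *)
From HB Require Import structures.
From mathcomp Require Import all_boot all_order all_algebra all_fingroup.

Set Implicit Arguments.
Unset Strict Implicit.
Unset Printing Implicit Defensive.

Import GRing.Theory.

Section Circuits.

(* ['Z_m] is the ring of integers mod [m] only for [1 < m]. *)
Variables m n : nat.

Inductive gate_label := Input of 'I_n | Mod of {set 'Z_m}.

Definition is_input (l : gate_label) : bool :=
  if l is Input _ then true else false.

(* [wires g h] is the number of wires leading from the child [h] into [g]. *)
Record circuit := Circuit {
  gate : finType;
  wires : gate -> gate -> nat;
  label : gate -> gate_label;
  output : gate;
  circuit_acyclic : forall p : seq gate,
    path.cycle (fun g h => 0 < wires g h) p -> p = [::];
  circuit_inputs : forall g,
    is_input (label g) = [forall h, wires g h == 0];
  circuit_variables : forall i : 'I_n, exists! g, label g = Input i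
}.

Definition edge (C : circuit) : rel (gate C) := fun g h => 0 < wires g h.

Section Semantics.

Variables (C : circuit) (x : 'I_n -> bool).

Definition gate_value (v : gate C -> bool) (g : gate C) : bool :=
  match label g with
  | Input i => x i
  | Mod A => ((\sum_h wires g h * v h)%:R)%R \in A
  end.

(* No path visits more than [#|gate C|] gates, so the values have stabilised
   after that many rounds: see [evalE] and [eval_unique]. *)
Definition eval : gate C -> bool :=
  iter #|gate C| gate_value (fun=> false).

Lemma gate_value_local (v w : gate C -> bool) g :
  (forall h, edge g h -> v h = w h) -> gate_value v g = gate_value w g.
Proof.
move=> vw; rewrite /gate_value; case: (label g) => // A.
congr ((_%:R)%R \in A); apply: eq_bigr => h _.
by case: (posnP (wires g h)) => [->//|gh]; rewrite vw.
Qed.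

Lemma path_uniq (g : gate C) p : path (@edge C) g p -> uniq (g :: p).
Proof.
elim: p g => // h p IH g gp; have hp : path (@edge C) h p by case/andP: gp.
rewrite cons_uniq (IH h hp) andbT; apply/negP => gin.
case/splitPr: gin gp => p1 p2.
rewrite cat_path => /andP[gp1 /= /andP[lg _]].
suff /(@circuit_acyclic C) : path.cycle (@edge C) (g :: p1) by [].
by rewrite /= rcons_path gp1.
Qed.

Lemma iter_stable k v w g :
  iter k gate_value v g != iter k gate_value w g ->
  exists2 p, path (@edge C) g p & size p = k.
Proof.
elim: k g => [|k IH] g; first by exists [::].
rewrite !iterS => ne.
have [h /andP[gh neh]|eqh] := pickP (fun h => edge g h &&
    (iter k gate_value v h != iter k gate_value w h)).
  by have [p hp sp] := IH h neh; exists (h :: p); rewrite /= ?gh ?sp.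
case/eqP: ne; apply: gate_value_local => h gh.
by have := eqh h; rewrite gh /= => /negbFE/eqP.
Qed.

Lemma iter_gates v w g :
  iter #|gate C| gate_value v g = iter #|gate C| gate_value w g.
Proof.
apply/eqP/negPn/negP => /iter_stable[p gp sp].
have := max_card (mem (g :: p)).
by rewrite (card_uniqP (path_uniq gp)) /= sp ltnn.
Qed.

Lemma evalE g : eval g = gate_value eval g.
Proof. by rewrite -[RHS]/(iter _.+1 _ _ g) iterSr (iter_gates _ (fun=> false)). Qed.

Lemma eval_unique v : (forall g, v g = gate_value v g) -> v =1 eval.
Proof.
move=> vE g; rewrite /eval -(iter_gates v).
elim: #|_| g => // k IH g; rewrite iterS vE.
by apply: gate_value_local => h _; apply: IH.
Qed.

End Semantics.

Definition computes_AND (C : circuit) : Prop :=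
  forall x : 'I_n -> bool, eval x (output C) = [forall i, x i].

Definition circuit_size (C : circuit) : nat :=
  #|gate C| + \sum_(g : gate C) \sum_(h : gate C) wires g h.

Definition output_path (C : circuit) (p : seq (gate C)) : bool :=
  path (@edge C) (output C) p && is_input (label (last (output C) p)).

Definition is_depth (C : circuit) (d : nat) : Prop :=
  (exists2 p, @output_path C p & size p = d) /\
  (forall p, @output_path C p -> size p <= d).

(* The output gate need not be fixed by [s]. *)
Definition extends_to_automorphism (C : circuit) (a : 'S_n)
    (s : {perm gate C}) : Prop :=
  [/\ forall g h, wires (s g) (s h) = wires g h,
      forall g A, label g = Mod A -> label (s g) = Mod A
    & forall g i, label g = Input i -> label (s g) = Input (a i)].

Definition symmetric_circuit (G : {group 'S_n}) (C : circuit) : Prop :=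
  forall a, a \in G -> exists s, @extends_to_automorphism C a s.

End Circuits.

Section Trees.

(* [k j] is the number of children of a node on level [j.+1]. The nodes on
   level [i] are numbered from left to right. *)
Variables (h : nat) (k : 'I_h -> nat).

Definition node : finType := {i : 'I_h.+1 & 'I_(\prod_(j < h | i <= j) k j)}.

Definition level (u : node) : nat := tag u.
Definition offset (u : node) : nat := tagged u.

Definition parent (u v : node) : bool :=
  [exists j : 'I_h,
    [&& level u == j.+1, level v == j & offset u == offset v %/ k j]].

Lemma node_inj (u v : node) : level u = level v -> offset u = offset v -> u = v.
Proof.
case: u v => [i u] [j v]; rewrite /level /offset /= => /val_inj ij.
by case: j / ij v => v /val_inj ->.
Qed.

Lemma card_root : #|[set u | level u == h]| = 1.
Proof.
have P0 : 0 < \prod_(j < h | (@ord_max h : 'I_h.+1) <= j) k j.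
  by rewrite big_pred0 // => j /=; rewrite leqNgt ltn_ord.
pose r : node := Tagged (fun i : 'I_h.+1 => 'I_(\prod_(j < h | i <= j) k j))
                        (Ordinal P0).
apply/eqP/cards1P; exists r; apply/setP => u; rewrite !inE.
apply/eqP/eqP => [hu|->//]; apply: node_inj => //.
case: u hu => i u; rewrite /level /offset /= => hi.
have P1 : \prod_(j < h | i <= j) k j = 1.
  by rewrite big_pred0 // => j; rewrite hi leqNgt ltn_ord.
by apply/eqP; rewrite -leqn0 -ltnS; have := ltn_ord u; rewrite [X in _ < X]P1.
Qed.

Lemma card_children (j : 'I_h) (u : node) :
  level u = j.+1 -> #|[set v | parent u v]| = k j.
Proof.
move=> uj.
have jh : j < h.+1 by rewrite ltnW // ltnS.
have pE : \prod_(l < h | Ordinal jh <= l) k l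
        = k j * \prod_(l < h | tag u <= l) k l.
  rewrite (bigD1 j) //=; congr (_ * _); apply: eq_bigl => l.
  by rewrite [nat_of_ord (tag u)]uj andbC eq_sym -ltn_neqAle.
have cP (c : 'I_(k j)) :
    offset u * k j + c < \prod_(l < h | Ordinal jh <= l) k l.
  rewrite pE mulnC; apply: (@leq_trans ((offset u).+1 * k j)).
    by rewrite mulSn addnC mulnC ltn_add2r.
  by rewrite mulnC leq_mul2l (ltn_ord (tagged u)) orbT.
pose f (c : 'I_(k j)) : node :=
  Tagged (fun i : 'I_h.+1 => 'I_(\prod_(l < h | i <= l) k l)) (Ordinal (cP c)).
have f_inj : injective f.
  move=> c d /(congr1 offset); rewrite /offset /= => /addnI; exact: val_inj.
rewrite -[RHS]card_ord -(card_imset _ f_inj).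
apply: eq_card => v; rewrite inE; apply/idP/imsetP.
  case/existsP => j' /and3P[]; rewrite uj eqSS => /eqP/val_inj <-.
  move=> /eqP vj /eqP uv.
  have kj0 : 0 < k j.
    rewrite lt0n; apply/negP => /eqP k0; case: v vj uv => i v /= vj _.
    have := ltn_ord v; rewrite [X in _ < X](bigD1 j) /= ?k0 //.
    by rewrite [nat_of_ord i]vj.
  exists (Ordinal (ltn_pmod (offset v) kj0)) => //.
  by apply: node_inj => //; rewrite {2}/offset /= uv -divn_eq.
case=> c _ ->; apply/existsP; exists j; apply/and3P; split.
- by rewrite uj.
- by [].
- have c0 : 0 < k j by apply: leq_ltn_trans (ltn_ord c).
  by rewrite {2}/offset /= divnMDl // divn_small ?addn0.
Qed.

Variables (n : nat) (kn : \prod_j k j = n).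

Definition leaf (i : 'I_n) : node :=
  Tagged (fun i : 'I_h.+1 => 'I_(\prod_(j < h | i <= j) k j))
         (cast_ord (esym kn) i : 'I_(\prod_(j < h | @ord0 h <= j) k j)).

Definition tree_automorphism (s : {perm node}) : bool :=
  [forall u, forall v, parent (s u) (s v) == parent u v].

Definition tree_aut : {set 'S_n} :=
  [set a : 'S_n | [exists s : {perm node},
     tree_automorphism s && [forall i, s (leaf i) == leaf (a i)]]].

Lemma tree_aut_group_set : group_set tree_aut.
Proof.
apply/group_setP; split=> [|a b].
  rewrite inE; apply/existsP; exists 1%g; apply/andP; split.
    by apply/'forall_forallP => u v; rewrite !perm1.
  by apply/forallP => i; rewrite !perm1.
rewrite !inE => /existsP[s /andP[sP /forallP sa]].
case/existsP=> t /andP[tP /forallP tb]; apply/existsP; exists (s * t)%g.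
apply/andP; split; last first.
  by apply/forallP => i; rewrite !permM (eqP (sa i)) (eqP (tb _)).
apply/'forall_forallP => u v; rewrite !permM.
by rewrite (eqP ('forall_forallP tP _ _)) (eqP ('forall_forallP sP _ _)).
Qed.

Canonical tree_aut_group := Group tree_aut_group_set.

End Trees.

(* Main.v *)
(** Lower bound. Fix all inputs to 1 outside the subtree of a node with
    [K = kmax n] children, and identify the leaves below each child: this leaves
    a Boolean function of [K] variables, and an assignment is a set [Y] of
    variables. Symmetry says that every translate under [Sym_K] of the sum [F]
    read by a gate is the sum read by some gate, so with fewer than [e!] gates
    the invariance group of [F] has index less than [e!]. Then it contains the
    symmetric group on all but [4e] points (as in Bochert's theorem: two
    elements whose supports share one point have a 3-cycle as commutator). By
    induction along the circuit, the value of a gate depends only on the trace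
    of [Y] on at most [d = 4e] points and on [#|Y|] modulo a number [M <= m d^r]
    all of whose prime divisors divide [m]. For the induction step at [p^a | m]
    take a power [q] of [p] dividing [M] and sum over all [M]-subsets of a set
    of size [M + q - 1]: the binomials ['C(M + q - 1 - j, M - j)] vanish mod
    [p^a] for [0 < j <= d], while ['C(M + q - 1, M)] is prime to [p]. AND is not
    of this form when [d + M <= K].

    Upper bound. If [s] inputs of [k < d^r] are 0, then [s = 0] iff for every
    prime [p | m] the power [Q] of [p] just above [d] divides [s], that is, iff
    [p] does not divide ['C(s + Q - 1, Q - 1)]. This is a combination of
    conjunctions of fewer than [Q] literals, each of which is, mod [p], a
    combination of [MOD_q] gates for another prime [q | m]. The resulting circuits
    of depth 2 are composed along the levels of the tree. *)

Require Import Defs.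
From mathcomp Require Import all_boot all_order all_algebra all_fingroup.
From mathcomp Require Import reals sequences exp zify ring lra.

Set Implicit Arguments.
Unset Strict Implicit.
Unset Printing Implicit Defensive.

(** * Binomial coefficients modulo prime powers *)

Section Binomials.

Variable p : nat.
Hypothesis p_pr : prime p.

(** With [q = p ^ (a + b)], the identity [N * 'C(N.-1, q.-1) = q * 'C(N, q)] loses at most [b]
    factors [p] to [N]. *)
Lemma dvdn_bin_pfactor a b N : ~~ (p ^ b.+1 %| N) ->
  p ^ a %| 'C(N.-1, (p ^ (a + b)).-1).
Proof.
move=> NbN; have N0 : 0 < N by case: N NbN => //; rewrite dvdn0.
have q0 : 0 < p ^ (a + b) by rewrite expn_gt0 prime_gt0.
have := mul_bin_diag N (p ^ (a + b)).-1; rewrite prednK // => E.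
have [->//|C0] := posnP 'C(N.-1, (p ^ (a + b)).-1).
rewrite pfactor_dvdn //; rewrite pfactor_dvdn // -ltnNge ltnS in NbN.
have : p ^ (a + b) %| N * 'C(N.-1, (p ^ (a + b)).-1) by rewrite E dvdn_mulr.
rewrite pfactor_dvdn ?muln_gt0 ?N0 // lognM //; lia.
Qed.

Lemma logn_addl_multiple e M j : p ^ e %| M -> 0 < j < p ^ e ->
  logn p (M + j) = logn p j.
Proof.
move=> eM /andP[j0 je].
have vlt : logn p j < e.
  rewrite -(ltn_exp2l _ _ (prime_gt1 p_pr)); apply: leq_ltn_trans je.
  by rewrite dvdn_leq // pfactor_dvdnn.
have Mj0 : 0 < M + j by lia.
have dM v : v <= e -> p ^ v %| M by move=> ve; apply: dvdn_trans eM; apply: dvdn_exp2l.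
apply/eqP; rewrite eqn_leq; apply/andP; split.
  rewrite leqNgt; apply/negP => lt.
  have : p ^ (logn p j).+1 %| M + j by rewrite pfactor_dvdn.
  by rewrite dvdn_addr ?dM // pfactor_dvdn // ltnn.
by rewrite -pfactor_dvdn // dvdn_addr ?dM ?pfactor_dvdnn // ltnW.
Qed.

(** Passing from [i] to [i.+1] multiplies the binomial by [(M + i.+1) / i.+1], whose numerator and
    denominator have the same [p]-adic valuation. *)
Lemma coprime_bin_pfactor e M : p ^ e %| M ->
  coprime p 'C(M + (p ^ e).-1, (p ^ e).-1).
Proof.
move=> eM; suff H i : i < p ^ e -> logn p 'C(M + i, i) = 0.
  have q0 : 0 < p ^ e by rewrite expn_gt0 prime_gt0.
  rewrite prime_coprime //; apply/negP.
  rewrite -{1}[p]expn1 pfactor_dvdn // ?H ?bin_gt0 ?leq_addl //; lia.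
elim: i => [|i IH] ie; first by rewrite bin0 logn1.
have := congr1 (logn p) (mul_bin_diag (M + i.+1) i).
rewrite !lognM ?bin_gt0; try lia.
by rewrite (logn_addl_multiple eM) //= addnS /= IH; lia.
Qed.

(** By symmetry the binomial is ['C(N.-1, q.-1)] with [q = p ^ (a + b)] and [N = M + q - j]. As [a]
    is positive, [p ^ b.+1] divides [M + q], hence not [N]. *)
Lemma dvdn_bin_draws a b M j : p ^ (a + b) %| M -> 0 < a ->
  0 < j < p ^ b.+1 -> j <= M ->
  p ^ a %| 'C(M + (p ^ (a + b)).-1 - j, M - j).
Proof.
move=> qM a0 /andP[j0 jp] jM.
have dq : p ^ b.+1 %| p ^ (a + b) by rewrite dvdn_exp2l // -add1n leq_add2r.
have := @dvdn_bin_pfactor a b (M + p ^ (a + b) - j).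
have: 0 < p ^ (a + b) by rewrite expn_gt0 prime_gt0.
move: (p ^ (a + b)) qM dq => q qM dq q0.
have E : (M + q - j).-1 = M - j + q.-1 by clear -jM q0; lia.
have E' : M + q.-1 - j = M - j + q.-1 by rewrite addnBAC.
rewrite E E' -bin_sub ?leq_addl // addnK; apply; apply/negP => dv.
have : p ^ b.+1 %| M + q - (M + q - j).
  by rewrite dvdn_sub // dvdn_add // (dvdn_trans dq).
by rewrite subKn ?(leq_trans jM) ?leq_addr // => /(dvdn_leq j0); rewrite leqNgt jp.
Qed.

End Binomials.

(* Pascal's rule propagates the vanishing of ['C(N - j, M - j)] away from the
   diagonal. *)
Lemma bin_dvd_off_diag n d N M : d <= M -> M <= N ->
  (forall j, 0 < j <= d -> n %| 'C(N - j, M - j)) ->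
  forall t j, 0 < j -> j + t <= d -> n %| 'C(N - (j + t), M - j).
Proof.
move=> dM MN H; elim=> [|t IH] j j0 jtd.
  by rewrite addn0; apply: H; rewrite j0 -[j]addn0.
have [u uE u'E] : exists2 u, N - (j + t) = u.+1 & N - (j + t.+1) = u.
  by exists (N - (j + t.+1)); lia.
have [v vE v'E] : exists2 v, M - j = v.+1 & M - j.+1 = v.
  by exists (M - j.+1); lia.
have := IH j.+1 isT; rewrite addSnnS v'E u'E => /(_ jtd) D1.
have := IH j j0; rewrite uE vE binS => D0.
by rewrite -(dvdn_addl _ D1) D0 //; lia.
Qed.

Lemma bin_mod_off_diag n d N M : d <= M -> M <= N ->
  (forall j, 0 < j <= d -> n %| 'C(N - j, M - j)) ->
  forall t, t <= d -> 'C(N - t, M) = 'C(N, M) %[mod n].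
Proof.
move=> dM MN H; elim=> [|t IH] td; first by rewrite subn0.
have [u uE u'E] : exists2 u, N - t = u.+1 & N - t.+1 = u.
  by exists (N - t.+1); lia.
have [v vE v'E] : exists2 v, M = v.+1 & M - 1 = v by exists (M - 1); lia.
rewrite -IH 1?ltnW // uE u'E vE binS -vE.
have := @bin_dvd_off_diag n d N M dM MN H t 1 isT; rewrite add1n u'E v'E => D.
by rewrite -modnDmr (eqP (D td)) addn0.
Qed.


Lemma eqn_modMl_coprime n c x y : coprime n c ->
  c * x = c * y %[mod n] -> x = y %[mod n].
Proof.
move=> nc; wlog xy : x y / x <= y.
  by move=> W; case: (leqP x y) => [|/ltnW] yx E; [|symmetry]; apply: W.
move/esym/eqP; rewrite eqn_mod_dvd ?leq_mul // -mulnBr Gauss_dvdr //.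
by rewrite -eqn_mod_dvd // => /eqP.
Qed.

(** * Sums of periodic functions *)

Section SubsetSums.

Variable T : finType.
Implicit Types A D V W Y : {set T}.

Lemma card_draws_trace A D V M : A \subset D -> D \subset V -> #|A| <= M ->
  #|[set W : {set T} | [&& W \subset V, #|W| == M & W :&: D == A]]|
    = 'C(#|V| - #|D|, M - #|A|).
Proof.
move=> AD DV AM.
have -> : #|V| - #|D| = #|V :\: D| by rewrite cardsD (setIidPr DV).
rewrite -cards_draws.
have AI W : [disjoint W & D] -> (A :|: W) :\: D = W.
  move=> dWD; rewrite setDUl (_ : A :\: D = set0) ?set0U.
    by apply/setDidPl.
  by apply/eqP; rewrite setD_eq0.
rewrite -[RHS](card_in_imset (f := fun W => A :|: W)); last first.
  move=> W W'; rewrite !inE !subsetD => /andP[/andP[_ dW] _].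
  by case/andP=> /andP[_ dW'] _ E; rewrite -(AI W dW) E AI.
apply: eq_card => W; rewrite !inE; apply/idP/imsetP.
  case/and3P=> sWV /eqP cW /eqP E; exists (W :\: D).
    by rewrite inE setSD // cardsD E cW eqxx.
  by rewrite -E setID.
case=> W'; rewrite inE subsetD => /andP[/andP[sV dD] /eqP cW] ->.
rewrite subUset sV (subset_trans AD DV) /= setIUl (setIidPl AD).
rewrite (_ : W' :&: D = set0); last by apply/eqP; rewrite setI_eq0.
rewrite setU0 eqxx andbT cardsU cW.
rewrite (_ : A :&: W' = set0) ?cards0 ?subn0 ?subnKC //.
by apply/eqP; rewrite setIC setI_eq0; apply: disjointWr AD dD.
Qed.

(** The sets [W] are grouped by their trace [A] on [V :&: D]. On each class [psi] is constant, and
    the size of the class is a binomial that vanishes mod [n] unless [A] is empty; for empty [A] the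
    value is [psi set0]. *)
Lemma sum_draws_mod n d M V D (psi : {set T} -> nat) :
    d <= M -> M <= #|V| -> #|D| <= d ->
    (forall j, 0 < j <= d -> n %| 'C(#|V| - j, M - j)) ->
    (forall W W', W \subset V -> W' \subset V -> #|W| = M ->
       #|W'| = M \/ W' = set0 -> W :&: D = W' :&: D -> psi W = psi W') ->
  \sum_(W : {set T} | (W \subset V) && (#|W| == M)) psi W
    = 'C(#|V|, M) * psi set0 %[mod n].
Proof.
move=> dM MV Dd H psiE; pose E := V :&: D.
have Ed : #|E| <= d by apply: leq_trans Dd; rewrite subset_leq_card // subsetIr.
have EV : E \subset V by apply: subsetIl.
have psiE' W W' : W \subset V -> W' \subset V -> #|W| = M ->
    #|W'| = M \/ W' = set0 -> W :&: E = W' :&: E -> psi W = psi W'.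
  move=> sW sW' cW cW'; rewrite /E !setIA (setIidPl sW) (setIidPl sW').
  exact: psiE.
rewrite (partition_big (fun W => W :&: E) (fun A => A \subset E)) /=; last first.
  by move=> W _; rewrite subsetIr.
rewrite (bigD1 set0) ?sub0set //=.
have sumA A c : A \subset E ->
    (forall W, W \subset V -> #|W| = M -> W :&: E = A -> psi W = c) ->
    \sum_(W : {set T} | (W \subset V) && (#|W| == M) && (W :&: E == A)) psi W
    = 'C(#|V| - #|E|, M - #|A|) * c.
  move=> AE psic; rewrite -card_draws_trace //; last first.
    by apply: leq_trans dM; apply: leq_trans Ed; apply: subset_leq_card.
  rewrite -sum_nat_const; apply: eq_big => W; first by rewrite inE andbA.
  by case/andP=> /andP[sW /eqP cW] /eqP AW; apply: psic.
rewrite (sumA _ (psi set0)) ?sub0set //; last first.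
  by move=> W sW cW W0; apply: psiE'; rewrite ?sub0set ?set0I //; right.
rewrite cards0 subn0 -modnDmr.
set rest := (X in _ + X %% n).
have /eqP-> : n %| rest; last rewrite addn0.
  apply: dvdn_sum => A /andP[AE A0].
  pose P W := [&& W \subset V, #|W| == M & W :&: E == A].
  have [W0 /and3P[sW0 /eqP cW0 /eqP W0A]|noW] := pickP P; last first.
    rewrite big_pred0 ?dvdn0 // => W; have := noW W; rewrite /P.
    by rewrite -andbA.
  rewrite (sumA _ (psi W0)) //; last first.
    by move=> W sW cW WA; apply: psiE' => //; [left | rewrite WA].
  apply: dvdn_mulr; have cAE : #|A| <= #|E| by apply: subset_leq_card.
  have A1 : 0 < #|A| by rewrite card_gt0.
  have := bin_dvd_off_diag dM MV H A1 (t := #|E| - #|A|).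
  by rewrite subnKC //; apply.
by rewrite -modnMml (bin_mod_off_diag dM MV H) // modnMml.
Qed.

Lemma subset_of_card V k : k <= #|V| -> exists2 W : {set T}, W \subset V & #|W| = k.
Proof.
move=> kV; have : 0 < #|[set W : {set T} | (W \subset V) && (#|W| == k)]|.
  by rewrite cards_draws bin_gt0.
by case/card_gt0P => W; rewrite inE => /andP[sW /eqP cW]; exists W.
Qed.

(** * Functions of a bounded trace and of the cardinality mod [M] *)

Definition periodic d M (f : {set T} -> bool) : Prop :=
  exists2 D : {set T}, #|D| <= d &
    forall Y Y', Y :&: D = Y' :&: D -> #|Y| = #|Y'| %[mod M] -> f Y = f Y'.

(** This is invariance under the permutations fixing all points outside [B]: their orbits on sets
    are given by the trace outside [B] and the cardinality. *)
Definition symmetric_on (B : {set T}) (F : {set T} -> nat) : Prop :=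
  forall Y Y', Y :\: B = Y' :\: B -> #|Y| = #|Y'| -> F Y = F Y'.

Lemma card_split B Y : #|Y| = #|Y :\: B| + #|Y :&: B|.
Proof. by rewrite addnC cardsID. Qed.

Section Step.

Variables (I : finType) (w : I -> nat) (f : I -> {set T} -> bool).
Variables (p a b d M : nat).
Hypotheses (p_pr : prime p) (dp : d < p ^ b.+1) (qM : p ^ (a + b) %| M).
Hypotheses (dM : d <= M) (a0 : 0 < a).

(** The weighted sum at [Y :|: W] is added up over the [M]-subsets [W] of a set [V] of size
    [M + q - 1] in [B :\: Y]. By symmetry each term is the value at [Y']; by periodicity and
    [sum_draws_mod] the total is ['C(#|V|, M)] times the value at [Y]. This binomial is prime to [p]
    and cancels. *)
Lemma slice_step B Y Y' : (forall i, periodic d M (f i)) ->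
  symmetric_on B (fun Y => \sum_i w i * f i Y) ->
  Y :\: B = Y' :\: B -> #|Y'| = #|Y| + M ->
  #|Y :&: B| + M + (p ^ (a + b)).-1 <= #|B| ->
  \sum_i w i * f i Y = \sum_i w i * f i Y' %[mod p ^ a].
Proof.
move=> fP Fsym YY' cY' roomB; move: (qM) roomB; set q := p ^ (a + b) => qM' roomB.
have [V sV cV] : exists2 V : {set T}, V \subset B :\: Y & #|V| = M + q.-1.
  apply: subset_of_card; rewrite cardsD setIC; lia.
have [VB VY] : V \subset B /\ [disjoint V & Y] by apply/andP; rewrite -subsetD.
have cop : coprime (p ^ a) 'C(#|V|, M).
  rewrite cV -bin_sub ?leq_addr // addKn.
  by rewrite coprimeXl // coprime_bin_pfactor.
have dvd j : 0 < j <= d -> p ^ a %| 'C(#|V| - j, M - j).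
  case/andP=> j0 jd; rewrite cV; apply: dvdn_bin_draws => //.
    by rewrite j0 (leq_ltn_trans jd).
  exact: leq_trans dM.
have cU W : W \subset V -> #|Y :|: W| = #|Y| + #|W|.
  move=> sW; rewrite cardsU (_ : Y :&: W = set0) ?cards0 ?subn0 //.
  by apply/eqP; rewrite setI_eq0 disjoint_sym (disjointWl sW).
have sumF : \sum_(W : {set T} | (W \subset V) && (#|W| == M))
    \sum_i w i * f i (Y :|: W) = 'C(#|V|, M) * \sum_i w i * f i Y'.
  rewrite -cards_draws -sum_nat_const; apply: eq_big => W; first by rewrite inE.
  case/andP=> sW /eqP cW; apply: Fsym.
    rewrite setDUl -YY' (_ : W :\: B = set0) ?setU0 //.
    by apply/eqP; rewrite setD_eq0 (subset_trans sW).
  by rewrite cU ?cW.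
have : \sum_(W : {set T} | (W \subset V) && (#|W| == M))
    \sum_i w i * f i (Y :|: W) = 'C(#|V|, M) * \sum_i w i * f i Y %[mod p ^ a].
  rewrite exchange_big big_distrr /= -modn_summ -[RHS]modn_summ; congr (_ %% _).
  apply: eq_bigr => i _; rewrite -big_distrr /= -modnMmr.
  have [D cD fD] := fP i.
  rewrite (@sum_draws_mod _ d M V D (fun W => f i (Y :|: W))) //; first last.
  - move=> W W' sW sW' cW cW' WW'; congr nat_of_bool; apply: fD.
      by rewrite !setIUl WW'.
    case: cW' => [cW'|->]; last rewrite setU0; rewrite !cU //.
      by rewrite cW cW'.
    by rewrite cW modnDr.
  - by rewrite cV leq_addr.
  by rewrite setU0 modnMmr mulnCA.
by rewrite sumF => /(eqn_modMl_coprime cop).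
Qed.


End Step.

Lemma periodic_compl d M g : periodic d M g -> periodic d M (fun Y => g (~: Y)).
Proof.
case=> D cD gD; exists D => // Y Y' YY' cYY'; apply: gD.
  by apply/setP => x; have /setP/(_ x) := YY'; rewrite !inE; case: (x \in D); lia.
apply/eqP; rewrite -(eqn_modDl #|Y|) cardsC -modnDml cYY' modnDml.
by rewrite cardsC.
Qed.

Lemma symmetric_on_compl B F :
  symmetric_on B F -> symmetric_on B (fun Y => F (~: Y)).
Proof.
move=> FB Y Y' YY' cYY'; apply: FB; last first.
  by apply: (@addnI #|Y|); rewrite cardsC cYY' cardsC.
by apply/setP => x; have /setP/(_ x) := YY'; rewrite !inE; case: (x \in B); lia.
Qed.

Section Slices.

Variables (I : finType) (w : I -> nat) (f : I -> {set T} -> bool).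
Variables (p a b d M : nat).
Hypotheses (p_pr : prime p) (dp : d < p ^ b.+1) (qM : p ^ (a + b) %| M).
Hypotheses (dM : d <= M) (a0 : 0 < a).

(** Induction on the number of steps of size [M] from [#|Y|] to [#|Y'|]. The size of [B] leaves room
    for the draws of each step either outside the smaller set or, after complementation, inside the
    larger one. *)
Lemma slice_mod B Y Y' : (forall i, periodic d M (f i)) ->
  symmetric_on B (fun Y => \sum_i w i * f i Y) ->
  M + 2 * p ^ (a + b) <= #|B| ->
  Y :\: B = Y' :\: B -> #|Y| = #|Y'| %[mod M] ->
  \sum_i w i * f i Y = \sum_i w i * f i Y' %[mod p ^ a].
Proof.
move=> fP Fsym roomB; wlog : Y Y' / #|Y| <= #|Y'|.
  by move=> W; case: (leqP #|Y| #|Y'|) => [|/ltnW] c E1 E2; [|symmetry]; apply: W.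
move=> le YY' cYY'.
have [l] : exists l, #|Y'| = #|Y| + l * M.
  have /dvdnP[l lE] : M %| #|Y'| - #|Y| by rewrite -eqn_mod_dvd // cYY'.
  by exists l; rewrite -lE subnKC.
elim: l Y' YY' {le cYY'} => [|l IH] Y' YY' cY'.
  by congr (_ %% _); apply: Fsym => //; lia.
have bY := card_split B Y; have bY' := card_split B Y'.
have bI := subset_leq_card (subsetIr Y' B).
have [Z0 sZ0 cZ0] : exists2 Z0 : {set T}, Z0 \subset Y' :&: B & #|Z0| = #|Y' :&: B| - M.
  by apply: subset_of_card; rewrite leq_subr.
have disj : (Y' :\: B) :&: Z0 = set0.
  apply/setP => x; rewrite !inE; apply/negP => /andP[/andP[xB _] /(subsetP sZ0)].
  by rewrite inE (negPf xB) andbF.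
pose Z := (Y' :\: B) :|: Z0.
have sZ0B : Z0 \subset B by apply: subset_trans sZ0 (subsetIr _ _).
have ZB : Z :\: B = Y' :\: B.
  rewrite setDUl setDDl setUid (_ : Z0 :\: B = set0) ?setU0 //.
  by apply/eqP; rewrite setD_eq0.
have ZIB : Z :&: B = Z0.
  by rewrite setIUl (setIidPl sZ0B) setDE -setIA [_ :&: B]setIC setICr setI0 set0U.
have cM : M <= #|Y' :&: B|.
  by move: bY bY' cY'; rewrite YY' mulSn; lia.
have cZ : #|Y'| = #|Z| + M.
  by rewrite (card_split B Z) bY' ZB ZIB cZ0; lia.
rewrite (IH Z) ?ZB //; last by move: cY'; rewrite mulSn; lia.
have q0 : 0 < p ^ (a + b) by rewrite expn_gt0 prime_gt0.
have [small|big] := leqP (#|Z :&: B| + M + (p ^ (a + b)).-1) #|B|.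
  exact: (slice_step p_pr dp qM dM a0 fP Fsym ZB).
(* Here [B :\: Z] is too small for the draws. Complements reverse the step, leading from [~: Y'] up
   to [~: Z], and the draws are made in [Y' :&: B]. *)
have YB : Y :&: B = B :\: ~: Y by rewrite setDE setCK setIC.
have cI W : #|B| = #|W :&: B| + #|~: W :&: B|.
  by rewrite -(cardsID W B) setIC setDE [B :&: ~: W]setIC.
have E Y0 : \sum_i w i * f i Y0 = \sum_i w i * f i (~: ~: Y0) by rewrite setCK.
symmetry; rewrite (E Y') (E Z).
apply: (@slice_step I w (fun i Y => f i (~: Y)) p a b d M p_pr dp qM dM a0 B) => //.
- by move=> i; apply: periodic_compl.
- exact: (symmetric_on_compl Fsym).
- by apply/setP => x; have /setP/(_ x) := ZB; rewrite !inE; case: (x \in B); lia.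
- by have := cardsC Y'; have := cardsC Z; lia.
- move: (cI Y') big; rewrite ZIB cZ0; move: cM roomB q0; clear; lia.
Qed.

End Slices.

Lemma eqn_mod_primes m x y : 0 < m ->
  (forall p, p \in primes m -> x = y %[mod p ^ logn p m]) -> x = y %[mod m].
Proof.
move=> m0; wlog xy : x y / x <= y.
  by move=> W; case: (leqP x y) => [|/ltnW] yx E; [|symmetry]; apply: W => // p /E.
move=> H; apply/esym/eqP; rewrite eqn_mod_dvd //; apply/dvdn_partP => // p pm.
by rewrite p_part -eqn_mod_dvd // H.
Qed.

(** For positive [d], [trunc_log p d] is the largest [b] with [p ^ b <= d]: so [d < p ^ b.+1], as
    the induction step requires, while each prime costs a factor of at most [d] beyond its part of
    [m]. *)
Definition modulus m d := \prod_(p <- primes m) p ^ (logn p m + trunc_log p d).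

Lemma modulus_gt0 m d : 0 < modulus m d.
Proof.
rewrite /modulus big_seq; apply: prodn_cond_gt0 => p.
by rewrite mem_primes => /and3P[pp _ _]; rewrite expn_gt0 prime_gt0.
Qed.

Lemma modulus_le m d : 0 < m -> 0 < d ->
  modulus m d <= m * d ^ size (primes m).
Proof.
move=> m0 d0; rewrite {2}(prod_prime_decomp m0) prime_decompE big_map /=.
rewrite -iter_muln_1 -count_predT -big_const_seq -big_split /= /modulus.
rewrite !(big_seq _ _ (primes m)) big_mkcond [leqRHS]big_mkcond /=.
apply: leq_prod => p _; case: ifP => // /[!mem_primes] /and3P[pp _ _].
by rewrite expnD leq_mul2l trunc_logP ?prime_gt1 ?orbT.
Qed.

Lemma pfactor_dvd_modulus m d p : p \in primes m ->
  p ^ (logn p m + trunc_log p d) %| modulus m d.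
Proof. by move=> pm; rewrite /modulus (big_rem p) //= dvdn_mulr. Qed.

(** The prime powers in [m] are treated separately, with the same [B]. Each [q = p ^ (a + b)]
    divides the modulus [M], so [M + 2 * q <= 3 * M]. *)
Lemma sum_mod (I : finType) (w : I -> nat) (f : I -> {set T} -> bool) m d B Y Y' :
  0 < m ->
  (forall i, periodic d (modulus m d) (f i)) ->
  symmetric_on B (fun Y => \sum_i w i * f i Y) ->
  3 * modulus m d <= #|B| ->
  Y :\: B = Y' :\: B -> #|Y| = #|Y'| %[mod modulus m d] ->
  \sum_i w i * f i Y = \sum_i w i * f i Y' %[mod m].
Proof.
move=> m0 fP Fsym roomB YY' cYY'; apply: eqn_mod_primes => // p pm.
have := pm; rewrite mem_primes => /and3P[pp _ pdm].
have a0 : 0 < logn p m by rewrite logn_gt0.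
have dp := trunc_log_ltn d (prime_gt1 pp).
have qM := pfactor_dvd_modulus d pm; have qleM := dvdn_leq (modulus_gt0 m d) qM.
apply: (slice_mod pp dp qM _ a0 fP Fsym) => //.
  apply: leq_trans qleM; apply: ltnW; apply: leq_trans dp _.
  by rewrite leq_exp2l ?prime_gt1 // -add1n leq_add2r.
by apply: leq_trans roomB; rewrite [3 * _]mulSn leq_add2l leq_mul2l.
Qed.

(** Removing from [setT] a set of [M] points that avoids [D] changes neither the trace on [D] nor
    the cardinality mod [M]. *)
Lemma setT_not_periodic d M : 0 < M -> d + M <= #|T| ->
  ~ periodic d M (fun Y => Y == setT).
Proof.
move=> M0 dM [D cD fD].
have [W sW cW] : exists2 W : {set T}, W \subset ~: D & #|W| = M.
  by apply: subset_of_card; rewrite cardsCs setCK; lia.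
have := fD setT (~: W); rewrite eqxx => /(_ _ _)/esym H.
suff /eqP : ~: W == setT.
  by move/(congr1 (@setC _)); rewrite setCK setCT => W0; rewrite W0 cards0 in cW; lia.
apply: H; last by rewrite cardsT -(cardsC W) cW modnDl.
rewrite setTI; apply/setP => x; rewrite !inE.
case xD: (x \in D); rewrite ?andbF // andbT; apply/esym/negP => /(subsetP sW).
by rewrite inE xD.
Qed.

End SubsetSums.

(** * Functions with few translates *)

Lemma bin_sub2 n u t : t <= u -> u <= n -> 'C(n - t, u - t) <= 'C(n, u).
Proof.
move=> + un; elim: t => [|t IH] tu; first by rewrite !subn0.
apply: leq_trans (IH (ltnW tu)).
have -> : u - t = (u - t.+1).+1 by lia.
by rewrite (_ : n - t = (n - t.+1).+1) ?binS ?leq_addl //; lia.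
Qed.

Lemma fact_le_bin e N : e * e <= N -> e`! <= 'C(N, e).
Proof.
move=> eN; rewrite -(leq_pmul2r (fact_gt0 e)) bin_ffact -ffactnn !ffact_prod.
rewrite -big_split /=; apply: leq_prod => i _; have := ltn_ord i; nia.
Qed.

(** By symmetry [u] is at most [n / 2]. Lowering both indices by [u - e] leaves
    ['C(n - (u - e), e)], whose upper index is still at least [e * e]. *)
Lemma fact_le_bin_mid e n u : e <= u -> u + e <= n -> 2 * (e * e) <= n ->
  e`! <= 'C(n, u).
Proof.
move=> eu un en; wlog u2 : u eu un / 2 * u <= n.
  move=> W; case: (leqP (2 * u) n) => [|nu]; first exact: W.
  by rewrite -bin_sub; [apply: W; lia | lia].
apply: leq_trans (bin_sub2 (leq_subr e u) _); last lia.
by rewrite subKn //; apply: fact_le_bin; lia.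
Qed.

Section Invariants.
Local Open Scope group_scope.

Variable T : finType.
Implicit Types (B D U V W X Y Z : {set T}) (g h : {perm T}).

Section InvariantGroup.

Variable F : {set T} -> nat.

Definition inv_set : {set {perm T}} := [set g : {perm T} | [forall Y : {set T}, F (g @: Y) == F Y]].

Lemma inv_setP g : reflect (forall Y, F (g @: Y) = F Y) (g \in inv_set).
Proof. by rewrite inE; apply: (iffP forallP) => H Y; apply/eqP. Qed.

Lemma imset_permM g h Y : (g * h) @: Y = h @: (g @: Y).
Proof. by rewrite -imset_comp; apply: eq_imset => x; rewrite /= permM. Qed.

Lemma mem_imset_perm g Y z : (z \in g @: Y) = (g^-1 z \in Y).
Proof. by rewrite -{1}[z](permKV g) mem_imset //; apply: perm_inj. Qed.

Lemma inv_group_set : group_set inv_set.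
Proof.
apply/group_setP; split; first by apply/inv_setP => Y; rewrite imset_perm1.
by move=> g h /inv_setP Fg /inv_setP Fh; apply/inv_setP => Y; rewrite imset_permM Fh.
Qed.
Canonical inv_group := Group inv_group_set.

(* [C_3] and [S_3] have the same orbits on the subsets of a 3-element set. *)
Lemma cycle3_tperm (c : {perm T}) i x y : uniq [:: i; x; y] ->
    c i = x -> c x = y -> c y = i -> (forall z, z \notin [:: i; x; y] -> c z = z) ->
  c \in inv_set -> tperm i x \in inv_set.
Proof.
move=> + ci cx cy cz cF; rewrite /= [_ \in [:: _]]inE negb_or andbT => /andP[/andP[ix iy] xy].
have cV : c^-1 \in inv_set by rewrite groupV.
have ci' : c^-1 i = y by rewrite -cy permK.
have cx' : c^-1 x = i by rewrite -ci permK.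
have cy' : c^-1 y = x by rewrite -cx permK.
have cz' z : z \notin [:: i; x; y] -> c^-1 z = z by move=> /cz{1}<-; rewrite permK.
apply/inv_setP => Y.
(* It suffices to find a power of [c] that changes the trace of [Y] on the three points as the
   transposition does; one of [1], [c], [c^-1] always serves. *)
have key (g : {perm T}) : g \in inv_set ->
    (i \in Y) = (g^-1 x \in Y) -> (x \in Y) = (g^-1 i \in Y) ->
    (y \in Y) = (g^-1 y \in Y) ->
    (forall z, z \notin [:: i; x; y] -> g^-1 z = z) -> F (tperm i x @: Y) = F Y.
  move=> /inv_setP Fg gi gx gy gz; rewrite -(Fg Y); congr F; apply/setP => z.
  rewrite !mem_imset_perm tpermV.
  have [zi|zi] := eqVneq z i; first by rewrite zi tpermL.
  have [zx|zx] := eqVneq z x; first by rewrite zx tpermR.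
  rewrite tpermD 1?eq_sym //; have [zy|zy] := eqVneq z y; first by rewrite zy.
  by rewrite gz // !inE !negb_or zi zx zy.
case iY: (i \in Y); case xY: (x \in Y); case yY: (y \in Y).
- by apply: (key 1); rewrite ?group1 ?invg1 ?perm1 ?iY ?xY ?yY // => z _; rewrite perm1.
- by apply: (key 1); rewrite ?group1 ?invg1 ?perm1 ?iY ?xY ?yY // => z _; rewrite perm1.
- by apply: (key c^-1); rewrite ?invgK ?ci ?cx ?cy ?iY ?xY ?yY.
- by apply: (key c); rewrite ?ci' ?cx' ?cy' ?iY ?xY ?yY.
- by apply: (key c); rewrite ?ci' ?cx' ?cy' ?iY ?xY ?yY.
- by apply: (key c^-1); rewrite ?invgK ?ci ?cx ?cy ?iY ?xY ?yY.
- by apply: (key 1); rewrite ?group1 ?invg1 ?perm1 ?iY ?xY ?yY // => z _; rewrite perm1.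
- by apply: (key 1); rewrite ?group1 ?invg1 ?perm1 ?iY ?xY ?yY // => z _; rewrite perm1.
Qed.

(** Swapping a point of [Y :\: Y'] with one of [Y' :\: Y], both in [B], preserves [F] and brings [Y]
    closer to [Y']. *)
Lemma symmetric_on_tperm B :
  {in B &, forall u v, tperm u v \in inv_set} -> symmetric_on B F.
Proof.
move=> BF Y Y' YY' cY; move: {2}(#|Y :\: Y'|) (leqnn #|Y :\: Y'|) => n.
elim: n Y YY' cY => [|n IH] Y YY' cY.
  rewrite leqn0 cards_eq0 setD_eq0 => sY; congr F; apply/eqP.
  by rewrite eqEcard sY cY leqnn.
have [|[u]] := set_0Vmem (Y :\: Y').
  by move=> /eqP; rewrite setD_eq0 => sY _; congr F; apply/eqP; rewrite eqEcard sY cY leqnn.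
have cD : #|Y :\: Y'| = #|Y' :\: Y|.
  by apply/eqP; rewrite -(eqn_add2l #|Y :&: Y'|) cardsID setIC cardsID cY.
rewrite inE => /andP[uY' uY] dn.
have : 0 < #|Y' :\: Y| by rewrite -cD card_gt0; apply/set0Pn; exists u; rewrite inE uY'.
case/card_gt0P => v; rewrite inE => /andP[vY vY'].
have inB z : (z \in Y) != (z \in Y') -> z \in B.
  by have /setP/(_ z) := YY'; rewrite !inE; case: (z \in B); rewrite //= => ->; rewrite eqxx.
have uB : u \in B by apply: inB; rewrite uY (negPf uY').
have vB : v \in B by apply: inB; rewrite vY' (negPf vY).
have /inv_setP Fuv := BF u v uB vB; rewrite -(Fuv Y).
have tE z : (z \in tperm u v @: Y) = (z == v) || (z != u) && (z \in Y).
  rewrite mem_imset_perm tpermV; case: tpermP => [->|->|/eqP zu /eqP zv].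
  - by rewrite (negPf vY) eqxx orbF; apply/esym/eqP => E; rewrite E vY' in uY'.
  - by rewrite uY eqxx.
  - by rewrite zu (negPf zv).
apply: IH.
- apply/setP => z; have /setP/(_ z) := YY'; rewrite !inE tE => <-.
  have [zB|zB] := boolP (z \in B); rewrite //=.
  have -> : z == v = false by apply: contraNF zB => /eqP->.
  by have -> : z != u by apply: contraNneq zB => ->.
- by rewrite card_imset //; apply: perm_inj.
- rewrite -ltnS; apply: leq_trans dn; apply: proper_card; apply/properP; split.
    apply/subsetP => z; rewrite !inE tE => /andP[zY' /orP[/eqP zv|/andP[_ ->]]].
      by rewrite zv vY' in zY'.
    by rewrite zY'.
  exists u; first by rewrite inE uY'.
  rewrite inE tE eqxx /= orbF uY' /=; apply/eqP => E; by rewrite E vY' in uY'.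
Qed.

End InvariantGroup.

Lemma perm_on_fix X (a : {perm T}) i : perm_on (i |: X) a -> a i = i -> perm_on X a.
Proof.
move=> aX ai; apply/subsetP => z; rewrite inE => az.
have := subsetP aX z; rewrite !inE az => /(_ isT)/predU1P[zi|//].
by rewrite zi ai eqxx in az.
Qed.

(** Only [i] is moved by both [a] and [b]. A point of [X] other than [a i] goes under [a^-1] to a
    point of [X], which [b] fixes, so the commutator fixes it; the points of [Y] other than [b i]
    are similar. *)
Lemma commg_cycle3 X Y i (a b : {perm T}) :
    [disjoint X & Y] -> i \notin X :|: Y ->
    perm_on (i |: X) a -> perm_on (i |: Y) b -> a i != i -> b i != i ->
  [/\ uniq [:: i; b i; a i], [~ a, b] i = b i, [~ a, b] (b i) = a i,
      [~ a, b] (a i) = i &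
      forall z, z \notin [:: i; b i; a i] -> [~ a, b] z = z].
Proof.
move=> XY; rewrite inE negb_or => /andP[iX iY] aX bY ai bi.
have aout z : z != i -> z \notin X -> a z = z.
  by move=> zi zX; apply: (out_perm aX); rewrite !inE negb_or zi.
have bout z : z != i -> z \notin Y -> b z = z.
  by move=> zi zY; apply: (out_perm bY); rewrite !inE negb_or zi.
have aV z : z != i -> z \notin X -> a^-1 z = z by move=> zi zX; rewrite -{1}(aout z) ?permK.
have bV z : z != i -> z \notin Y -> b^-1 z = z by move=> zi zY; rewrite -{1}(bout z) ?permK.
have XnY z : z \in X -> z \notin Y by move=> zX; rewrite (disjointFr XY).
have YnX z : z \in Y -> z \notin X by move=> zY; rewrite (disjointFl XY).
have inX (u : {perm T}) z : perm_on (i |: X) u -> z \in X -> u z != i -> u z \in X.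
  by move=> uX zX uz; have := perm_closed z uX; rewrite !inE zX orbT (negPf uz).
have inY (u : {perm T}) z : perm_on (i |: Y) u -> z \in Y -> u z != i -> u z \in Y.
  by move=> uY zY uz; have := perm_closed z uY; rewrite !inE zY orbT (negPf uz).
have aiX : a i \in X.
  by have := perm_closed i aX; rewrite !inE eqxx (negPf ai).
have biY : b i \in Y.
  by have := perm_closed i bY; rewrite !inE eqxx (negPf bi).
have aVX : perm_on (i |: X) a^-1 by rewrite perm_onV.
have bVY : perm_on (i |: Y) b^-1 by rewrite perm_onV.
have aVi : a^-1 i != i by apply: contraNneq ai => E; rewrite -{1}E permKV.
have bVi : b^-1 i != i by apply: contraNneq bi => E; rewrite -{1}E permKV.
have aViX : a^-1 i \in X.
  by have := perm_closed i aVX; rewrite !inE eqxx (negPf aVi).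
have bViY : b^-1 i \in Y.
  by have := perm_closed i bVY; rewrite !inE eqxx (negPf bVi).
have cE z : [~ a, b] z = b (a (b^-1 (a^-1 z))) by rewrite /commg /conjg !permM.
split.
- rewrite /= [i \in _]inE [_ \in [:: a i]]inE [_ \in [:: a i]]inE.
  rewrite negb_or [i == b i]eq_sym bi [i == a i]eq_sym ai /= andbT.
  by apply: contraTneq aiX => <-; apply: YnX.
- by rewrite cE bV ?XnY // permKV.
- by rewrite cE aV ?YnX // permK bout ?XnY.
- by rewrite cE permK aout ?YnX // permKV.
move=> z; rewrite !inE !negb_or => /and3P[zi zb za].
rewrite cE; have [zX|zX] := boolP (z \in X).
  have az : a^-1 z != i by apply: contraNneq za => <-; rewrite permKV.
  by rewrite bV ?XnY ?inX // permKV bout ?XnY.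
rewrite aV //; have [zY|zY] := boolP (z \in Y); last by rewrite bV // aout // bout.
have bz : b^-1 z != i by apply: contraNneq zb => <-; rewrite permKV.
by rewrite aout ?YnX ?inY // permKV.
Qed.

Lemma card_perm_stable (K : {set {perm T}}) Z U :
    {in K, forall g, perm_on Z g} ->
    {in K, forall g, {in U :&: Z, forall z, g z \in U}} ->
  (#|K| <= #|U :&: Z|`! * #|Z :\: U|`!)%N.
Proof.
move=> KZ KU; rewrite -!card_Sym (mul_cardG (Sym_group _) (Sym_group _)).
apply: leq_trans (leq_pmulr _ (cardG_gt0 _)).
apply/subset_leq_card/subsetP => g gK; have gZ := KZ g gK.
pose A := U :&: Z.
have gA z : z \in A -> g z \in A.
  by move=> zA; rewrite inE KU //= perm_closed //; move: zA; rewrite inE => /andP[].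
have gAE : g @: A = A.
  apply/eqP; rewrite eqEcard card_imset ?leqnn ?andbT; last exact: perm_inj.
  by apply/subsetP => _ /imsetP[z zA ->]; apply: gA.
have gN : g \in 'N(A | 'P).
  by apply/astabsP => z; rewrite /= apermE -{1}gAE mem_imset //; apply: perm_inj.
have rA := restr_perm_on A g.
rewrite -[g](mulKVg (restr_perm A g)); apply: mem_mulg; first by rewrite inE.
rewrite inE; apply/subsetP => z; apply: contraR; rewrite !inE permM => zZU.
have [zA|zA] := boolP (z \in A).
  rewrite -(restr_permE gN) ?permKV // perm_closed ?perm_onV //.
rewrite (out_perm (perm_onV rA)) //; apply/eqP; apply: (out_perm gZ).
by move: zA zZU; rewrite inE; case: (z \in U); case: (z \in Z).
Qed.

Section Support.

Variables (F : {set T} -> nat) (s e : nat).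
Let H := inv_group F.
Hypothesis index_le : forall L : {group {perm T}}, (#|L| <= s * #|L :&: H|)%N.
Hypotheses (se : (s < e`!)%N) (e_small : (2 * (e * e) + 2 * e <= #|T|)%N).

Definition indep X := Sym X :&: H \subset [1].

Lemma indep_card X : indep X -> (#|X| < e)%N.
Proof.
move=> iX; rewrite ltnNge; apply/negP => eX.
have := index_le (Sym_group X); rewrite /= card_Sym => le.
have := leq_trans (leq_fact eX) le; rewrite leqNgt => /negP; apply.
apply: leq_ltn_trans se; rewrite -{2}[s]muln1 leq_mul2l.
by rewrite (leq_trans (subset_leq_card iX)) ?cards1 ?orbT.
Qed.

Lemma maximal_indep V : exists X,
  [/\ X \subset V, indep X & forall i, i \in V :\: X ->
      exists2 a : {perm T}, a \in H & perm_on (i |: X) a /\ a i != i].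
Proof.
pose P X := (X \subset V) && indep X.
have P0 : P set0.
  rewrite /P sub0set; apply/subsetP => a; rewrite inE => /andP[aS _].
  rewrite inE; apply/eqP/permP => z; rewrite perm1.
  by apply: (@out_perm _ set0); rewrite ?inE // in aS *.
have [X /maxsetP[/andP[XV iX] Xmax] _] := maxset_exists P0.
exists X; split=> // i; rewrite inE => /andP[iX' iV].
have : ~~ indep (i |: X).
  apply/negP => iiX; have := Xmax (i |: X).
  rewrite /P subUset sub1set iV XV iiX subsetUr => /(_ isT isT) E.
  by rewrite -E !inE eqxx in iX'.
case/subsetPn => a; rewrite inE => /andP[aS aH] a1; exists a => //.
have aS' : perm_on (i |: X) a by rewrite inE in aS.
split=> //; apply: contraNneq a1 => ai; apply: (subsetP iX).
by rewrite inE aH andbT inE; apply: perm_on_fix ai.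
Qed.

(** Being exchanged by a transposition in [H] is an equivalence relation [E]. For [X] maximal
    independent, [Y] maximal independent off [X] and [Z] the rest, every union of classes contains
    fewer than [e] points of [Z] or misses fewer than [e]. Adding a class to a maximal union of the
    first kind gives one of the second, so that class has more than [#|Z| - 2 * e] points. *)
Lemma large_class : exists B : {set T}, (#|~: B| <= 4 * e)%N /\
  {in B &, forall u v, tperm u v \in inv_set F}.
Proof.
have [X [_ iX Xa]] := maximal_indep setT.
have [Y [YX iY Yb]] := maximal_indep (~: X).
have cX := indep_card iX; have cY := indep_card iY.
pose Z := ~: (X :|: Y).
have dXY : [disjoint X & Y].
  by rewrite disjoint_sym disjoints_subset.
pose E u v := tperm u v \in H.
have Esym u v : E u v = E v u by rewrite /E tpermC.
have Etr u v w : E u v -> E v w -> E u w.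
  rewrite /E; have [->//|uv] := eqVneq u v; have [->//|vw] := eqVneq v w.
  have [-> _ _|uw] := eqVneq u w; first by rewrite tperm1 group1.
  move=> uvH vwH; have : tperm u v ^ tperm v w \in H by rewrite groupJ.
  by rewrite tpermJ tpermL tpermD // eq_sym.
(* The elements of [H] provided by [X] and by [Y] have supports meeting only in [i], so their
   commutator is a 3-cycle through [i] and a point of [X]. *)
have linkX i : i \in Z -> exists2 x, x \in X & E i x.
  rewrite inE => iXY; have := iXY; rewrite inE negb_or => /andP[niX niY].
  have iX' : i \in setT :\: X by rewrite !inE niX.
  have iY' : i \in ~: X :\: Y by rewrite !inE niX niY.
  have [[a aH [aX ai]] [b bH [bY bi]]] := (Xa i iX', Yb i iY').
  have [Hu Hi Hb Ha Hz] := commg_cycle3 dXY iXY aX bY ai bi.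
  exists (a i).
    by have := perm_closed i aX; rewrite !inE eqxx (negPf ai).
  rewrite Esym; apply: (@cycle3_tperm F [~ a, b] (a i) i (b i)) => //.
  - move: Hu; rewrite /= !inE !negb_or !andbT => /andP[/andP[ib ia] ba].
    by rewrite [a i == i]eq_sym ia [a i == b i]eq_sym ba ib.
  - by move=> z zn; apply: Hz; move: zn; rewrite !inE !negb_or => /and3P[-> -> ->].
  - by rewrite groupR.
(* Otherwise, as [Sym Z :&: H] preserves [U :&: Z], its index in [Sym Z] is at least
   ['C(#|Z|, #|U :&: Z|) >= e!]. *)
have saturated_card U : {in U, forall u v, E u v -> v \in U} ->
    (#|U :&: Z| < e)%N || (#|Z| < #|U :&: Z| + e)%N.
  move=> satU; rewrite -implyNb -leqNgt; apply/implyP => eU; rewrite ltnNge; apply/negP => Ue.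
  have cZ : (#|Z| + (#|X| + #|Y|) >= #|T|)%N.
    rewrite -(cardsC Z) leq_add2l /Z setCK cardsU leq_subr //.
  have := fact_le_bin_mid eU Ue.
  have -> : (2 * (e * e) <= #|Z|)%N by lia.
  move=> /(_ isT); rewrite leqNgt => /negP; apply; apply: leq_ltn_trans se.
  have UZ : (#|U :&: Z| <= #|Z|)%N by rewrite subset_leq_card // subsetIr.
  rewrite -(leq_pmul2r (_ : (0 < #|U :&: Z|`! * (#|Z| - #|U :&: Z|)`!)%N)) ?muln_gt0 ?fact_gt0 //.
  rewrite bin_fact // -card_Sym; apply: leq_trans (index_le (Sym_group Z)) _.
  rewrite leq_mul2l; apply/orP; right.
  rewrite [U :&: Z]setIC -cardsD; apply: leq_trans (card_perm_stable (U := U) (Z := Z) _ _) _.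
  - by move=> g; rewrite inE => /andP[]; rewrite inE.
  - move=> g; rewrite inE => /andP[gS gH] u; rewrite inE => /andP[uU uZ].
    have gZ : perm_on Z g by rewrite inE in gS.
    (* Conjugation by [g], which fixes [x], turns the transposition of [u] and [x] into that of
       [g u] and [x], so [g u] stays in the class of [x]. *)
    have [x xX ux] := linkX u uZ.
    have gx : g x = x by apply: (out_perm gZ); rewrite !inE xX.
    have xU : x \in U by apply: satU ux.
    apply: (satU x xU); rewrite Esym -gx /E -tpermJ groupJ //.
  - by rewrite [Z :&: U]setIC.
pose P U := [forall u in U, forall v, E u v ==> (v \in U)] && (#|U :&: Z| < e)%N.
have PP U : reflect {in U, forall u v, E u v -> v \in U} [forall u in U, forall v, E u v ==> (v \in U)].
  apply: (iffP forall_inP) => [HU u uU v|HU u uU].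
    by apply/implyP; move/forallP: (HU u uU).
  by apply/forallP => v; apply/implyP; apply: HU.
have P0 : P set0.
  rewrite /P set0I cards0 (leq_ltn_trans _ cX) // andbT.
  by apply/PP => u; rewrite inE.
have [U /maxsetP[/andP[/PP satU Ue] Umax] _] := maxset_exists P0.
have cZ : (#|Z| + (#|X| + #|Y|) >= #|T|)%N.
  by rewrite -(cardsC Z) leq_add2l /Z setCK cardsU leq_subr.
have : ~~ (Z \subset U).
  apply/negP => ZU; have := Ue; rewrite (setIidPr ZU).
  move: cX cY cZ e_small; clear; nia.
case/subsetPn => z zZ zU; pose B := [set v | E z v].
have zB : z \in B by rewrite inE /E tperm1 group1.
have satUB : {in U :|: B, forall u v, E u v -> v \in U :|: B}.
  move=> u; rewrite !inE => /orP[uU|zu] v uv; rewrite !inE.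
    by rewrite (satU u uU).
  by rewrite (Etr z u v) ?orbT.
have big : (#|Z| < #|(U :|: B) :&: Z| + e)%N.
  have /orP[small|//] := saturated_card _ satUB.
  have := Umax (U :|: B); rewrite /P small subsetUl andbT => H1.
  suff E1 : U :|: B = U by rewrite -E1 inE zB orbT in zU.
  by apply: H1 => //; apply/PP.
exists B; split.
  have : (#|(U :|: B) :&: Z| <= #|U :&: Z| + #|B|)%N.
    rewrite setIUl cardsU; apply: leq_trans (leq_subr _ _) _.
    by rewrite leq_add2l subset_leq_card // subsetIl.
  have := cardsC B; move: big Ue cX cY cZ; clear; lia.
move=> u v; rewrite [u \in B]inE [v \in B]inE => zu zv.
by apply: (Etr u z v) => //; rewrite Esym.
Qed.
End Support.
End Invariants.

(** * Symmetric circuits *)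

Import GRing.Theory.

Lemma Zp_nat_eqmod m x y : 1 < m -> x = y %[mod m] -> (x%:R = y%:R :> 'Z_m)%R.
Proof. by move=> m1 E; apply: ord_inj; rewrite !val_Zp_nat. Qed.

Section Restriction.

Variables (m n : nat) (C : circuit m n) (G : {group 'S_n}).
Variables (T : finType) (X : {set T} -> 'I_n -> bool).
Hypothesis m1 : 1 < m.
Hypothesis X_input : forall i,
  (exists c, forall Y, X Y i = (c \in Y)) \/ (forall Y, X Y i = true).
Hypothesis X_sym : forall t : {perm T}, exists2 a, a \in G &
  forall (Y : {set T}) i, X (t @: Y) (a i) = X Y i.
Hypothesis X_AND : forall Y, [forall i, X Y i] = (Y == setT).
Hypothesis C_sym : symmetric_circuit G C.
Hypothesis C_AND : computes_AND C.

Let v j Y : gate C -> bool := iter j (gate_value (X Y)) (fun=> false).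
Let S j g Y := \sum_h wires g h * v j Y h.

Lemma iter_equivariant (t : {perm T}) : exists s : {perm gate C},
  (forall g h, wires (s g) (s h) = wires g h) /\
  (forall j (Y : {set T}) g, v j (t @: Y) (s g) = v j Y g).
Proof.
have [a aG Xa] := X_sym t; have [s [sw sM sI]] := C_sym aG.
exists s; split=> //; elim=> // j IH Y g; rewrite /v !iterS /gate_value.
case E : (label g) => [i|A]; first by rewrite (sI _ _ E) Xa.
rewrite (sM _ _ E); congr ((_%:R)%R \in A).
rewrite (reindex_inj (@perm_inj _ s)) /=; apply: eq_bigr => h _.
by rewrite sw -/(v _ _ _) IH.
Qed.

Lemma sum_equivariant j g (t : {perm T}) :
  exists g', [forall Y : {set T}, S j g' (t @: Y) == S j g Y].
Proof.
have [s [sw vs]] := iter_equivariant t.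
exists (s g); apply/forallP => Y; apply/eqP.
rewrite /S (reindex_inj (@perm_inj _ s)) /=; apply: eq_bigr => h _.
by rewrite sw vs.
Qed.

Local Open Scope group_scope.

(* The translates of a gate are gates, so the orbit of [S j g] has at most
   [#|gate C|] members. *)
Lemma index_inv_le j g (L : {group {perm T}}) :
  (#|L| <= #|gate C| * #|L :&: inv_group (S j g)|)%N.
Proof.
pose f t := xchoose (sum_equivariant j g t).
have fP t (Y : {set T}) : S j (f t) (t @: Y) = S j g Y.
  by have /forallP/(_ Y)/eqP := xchooseP (sum_equivariant j g t).
rewrite -sum1_card (partition_big f predT) //= -sum_nat_const.
apply: leq_sum => g' _; rewrite sum1_card.
have [t0 /andP[t0L /eqP t0g]|no] := pickP [pred t | (t \in L) && (f t == g')]; last by rewrite eq_card0.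
(* Permutations taking the sum at [g] to the sum at the same gate differ by an element of the
   invariance group. *)
rewrite -(card_rcoset _ t0); apply/subset_leq_card/subsetP => t.
case/andP=> tL /eqP tg.
rewrite mem_rcoset inE groupM ?groupV //=; apply/inv_setP => Y.
rewrite imset_permM -(fP t0) t0g -imset_permM mulVg imset_perm1.
by rewrite -tg fP.
Qed.

Local Open Scope nat_scope.

Variables (d e : nat).
Hypotheses (d0 : 0 < d) (e_d : 4 * e <= d).
Hypothesis e_small : 2 * (e * e) + 2 * e <= #|T|.
Hypothesis d_small : d + 3 * modulus m d <= #|T|.

(** With fewer than [e!] gates, every gate in every round, and so the output, would compute a
    periodic function of [Y], which AND is not. *)
Lemma fact_le_gates : e`! <= #|gate C|.
Proof.
rewrite leqNgt; apply/negP => small.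
have P j g : periodic d (modulus m d) (fun Y => v j Y g).
  elim: j g => [|j IH] g; first by exists set0; rewrite ?cards0.
  case E : (label g) => [i|A].
    have vE Y : v j.+1 Y g = X Y i by rewrite /v iterS /gate_value E.
    have [[c Xc]|XT] := X_input i; last first.
      by exists set0; rewrite ?cards0 // => Y Y' _ _; rewrite !vE !XT.
    exists [set c]; rewrite ?cards1 // => Y Y' YY' _; rewrite !vE !Xc.
    by have /setP/(_ c) := YY'; rewrite !inE eqxx !andbT.
  have [B [cB BF]] := large_class (index_inv_le j g) small e_small.
  exists (~: B); first by apply: leq_trans e_d.
  move=> Y Y' YY' cYY'; rewrite /v !iterS /gate_value E.
  congr (_ \in A); apply: Zp_nat_eqmod => //.
  apply: (@sum_mod _ _ (wires g) (fun h Y => v j Y h) _ d B) => //; first exact: ltnW.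
  - exact: (symmetric_on_tperm BF).
  - by have := cardsC B; lia.
  - by rewrite !setDE.
have := @setT_not_periodic T d (modulus m d) (modulus_gt0 m d).
case; first by apply: leq_trans d_small; rewrite leq_add2l leq_pmull.
have [D cD vD] := P #|gate C| (output C); exists D => // Y Y' YY' cYY'.
by rewrite -!X_AND -!C_AND; apply: vD.
Qed.

End Restriction.

(** * Permuting the children of a tree node *)

Section ChildPermutations.

Variables (h n : nat) (k : 'I_h -> nat) (kn : \prod_j k j = n) (j0 : 'I_h).
Hypothesis n0 : 0 < n.
Implicit Types (t : {perm 'I_(k j0)}).

(** A node on level [j0] has [below l] descendants on a level [l <= j0]. As nodes are numbered from
    left to right, dividing an offset by [below l] gives that of the ancestor on level [j0]. *)
Let below l := \prod_(j < h | l <= j < j0) k j.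
Let width l := \prod_(j < h | l <= j) k j.

Lemma arity_gt0 j : 0 < k j.
Proof. by move: n0; rewrite -kn (bigD1 j) //= muln_gt0 => /andP[]. Qed.

Lemma below_gt0 l : 0 < below l.
Proof. by apply: prodn_gt0 => j; apply: arity_gt0. Qed.

Lemma belowS (j : 'I_h) : j < j0 -> below j = below j.+1 * k j.
Proof.
move=> jj0; rewrite /below (bigD1 j) ?leqnn //= mulnC; congr (_ * _).
by apply: eq_bigl => l; rewrite -val_eqE /=; lia.
Qed.

Lemma below_j0 : below j0 = 1.
Proof. by rewrite /below big_pred0 // => j; lia. Qed.

Lemma width_below l : l <= j0 -> width l = width j0 * below l.
Proof.
move=> lj0; rewrite /width (bigID (fun j : 'I_h => j < j0)) /= mulnC; congr (_ * _).
by apply: eq_bigl => j; lia.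
Qed.

Lemma arity_le_width : k j0 <= width j0.
Proof.
rewrite /width (bigD1 j0) //= leq_pmulr //.
by apply: prodn_gt0 => j; apply: arity_gt0.
Qed.

Definition extend_perm t (a : nat) : nat :=
  if insub a is Some c then val (t c) else a.

Lemma extend_perm_ord t (c : 'I_(k j0)) : extend_perm t c = t c.
Proof. by rewrite /extend_perm valK. Qed.

Lemma extend_perm_out t a : k j0 <= a -> extend_perm t a = a.
Proof. by move=> ka; rewrite /extend_perm insubN // -leqNgt. Qed.

Lemma extend_permK t a : extend_perm t^-1 (extend_perm t a) = a.
Proof.
have [ka|ak] := leqP (k j0) a; first by rewrite !extend_perm_out.
by rewrite -[a]/(val (Ordinal ak)) !extend_perm_ord permK.
Qed.

Lemma extend_perm_bound t a b : k j0 <= b -> a < b -> extend_perm t a < b.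
Proof.
by move=> kb ab; rewrite /extend_perm; case: insubP => // c _ _; apply: leq_trans (ltn_ord _) kb.
Qed.

Lemma extend_perm_div t a : extend_perm t a %/ k j0 = a %/ k j0.
Proof.
rewrite /extend_perm; case: insubP => // c _ <-.
by rewrite !divn_small // ltn_ord.
Qed.

(* The first [k j0] nodes on level [j0], which are the children of the first
   node on the level above, are permuted together with their subtrees. *)
Definition move_offset t l o :=
  if l <= j0 then extend_perm t (o %/ below l) * below l + o %% below l else o.

Lemma move_offset_div t l o : l <= j0 ->
  move_offset t l o %/ below l = extend_perm t (o %/ below l).
Proof.
by move=> lj0; rewrite /move_offset lj0 divnMDl ?below_gt0 // [_ %% _ %/ _]divn_small ?addn0 ?ltn_mod ?below_gt0.
Qed.

Lemma move_offsetK t l o : move_offset t^-1 l (move_offset t l o) = o.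
Proof.
rewrite {1}/move_offset; case: ifP => lj0; last by rewrite /move_offset lj0.
rewrite move_offset_div // extend_permK /move_offset lj0 modnMDl modn_mod.
by rewrite -divn_eq.
Qed.

Lemma move_offset_bound t l o : o < width l -> move_offset t l o < width l.
Proof.
rewrite /move_offset; case: ifP => // lj0; rewrite width_below // => ow.
have : extend_perm t (o %/ below l) < width j0.
  by apply: extend_perm_bound arity_le_width _; rewrite ltn_divLR // below_gt0.
rewrite -(leq_pmul2r (below_gt0 l)) => H; apply: leq_trans H.
by rewrite mulSn addnC ltn_add2r ltn_mod below_gt0.
Qed.

(** Below level [j0] siblings move within one block; on level [j0] the permuted nodes are all
    children of the first node above; higher up nothing moves. *)
Lemma move_offset_parent t (j : 'I_h) o :
  move_offset t j o %/ k j = move_offset t j.+1 (o %/ k j).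
Proof.
rewrite /move_offset; have [jj0|j0j|/val_inj ->] := ltngtP j j0 => //.
  rewrite belowS // mulnA divnMDl ?arity_gt0 // -divnMA [k j * _]mulnC.
  by rewrite modn_divl.
by rewrite below_j0 muln1 divn1 modn1 addn0 extend_perm_div.
Qed.

Definition move_node t (u : node k) : node k :=
  Tagged (fun i : 'I_h.+1 => 'I_(\prod_(j < h | i <= j) k j))
    (Ordinal (move_offset_bound t (ltn_ord (tagged u)))).

Lemma move_nodeK t : cancel (move_node t) (move_node t^-1).
Proof. by move=> u; apply: node_inj => //; apply: move_offsetK. Qed.

Lemma move_node_parent t u v : parent u v -> parent (move_node t u) (move_node t v).
Proof.
case/existsP=> j /and3P[/eqP uj /eqP vj /eqP uv]; apply/existsP; exists j.
apply/and3P; split; [exact/eqP | exact/eqP |].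
have E w : offset (move_node t w) = move_offset t (level w) (offset w) by [].
by rewrite !E uj vj uv move_offset_parent.
Qed.

Lemma width0 : width 0 = n.
Proof. by rewrite -kn; apply: eq_bigl. Qed.

Lemma move_leaf_bound t (i : 'I_n) : move_offset t 0 i < n.
Proof. by have := @move_offset_bound t 0 i; rewrite width0; apply. Qed.

Definition move_leaf t (i : 'I_n) : 'I_n := Ordinal (move_leaf_bound t i).

Lemma move_leaf_inj t : injective (move_leaf t).
Proof.
apply: (can_inj (g := move_leaf t^-1)) => i; apply: val_inj.
exact: move_offsetK.
Qed.

Lemma move_leaf_tree_aut t : perm (@move_leaf_inj t) \in tree_aut_group kn.
Proof.
rewrite inE; apply/existsP; exists (perm (can_inj (move_nodeK t))).
apply/andP; split.
  apply/'forall_forallP => u v; rewrite !permE; apply/eqP; apply/idP/idP.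
    by move/(move_node_parent t^-1); rewrite !move_nodeK.
  exact: move_node_parent.
by apply/forallP => i; rewrite !permE; apply/eqP; apply: node_inj.
Qed.

(** [i %/ below 0] is the ancestor of the leaf [i] on level [j0]. If it is not one of the [k j0]
    permuted nodes, [insub] gives [None] and the input is fixed to 1. *)
Definition restrict (Y : {set 'I_(k j0)}) (i : 'I_n) : bool :=
  if insub (i %/ below 0) is Some c then c \in Y else true.

Lemma restrict_input i :
  (exists c, forall Y, restrict Y i = (c \in Y)) \/ (forall Y, restrict Y i = true).
Proof.
by rewrite /restrict; case: (insub _) => [c|]; [left; exists c | right].
Qed.

Lemma restrict_sym t : exists2 a, a \in tree_aut_group kn &
  forall (Y : {set 'I_(k j0)}) i, restrict (t @: Y) (a i) = restrict Y i.
Proof.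
exists (perm (@move_leaf_inj t)); first exact: move_leaf_tree_aut.
move=> Y i; rewrite permE /restrict /= move_offset_div //.
have [ka|ak] := leqP (k j0) (i %/ below 0).
  by rewrite extend_perm_out // !insubN // -leqNgt.
rewrite -[i %/ below 0]/(val (Ordinal ak)) extend_perm_ord !valK.
by rewrite mem_imset //; apply: perm_inj.
Qed.

Lemma restrict_AND Y : [forall i, restrict Y i] = (Y == setT).
Proof.
apply/forallP/eqP => [YT|-> i]; last first.
  by rewrite /restrict; case: (insub _) => // c; rewrite inE.
apply/setP => c; rewrite inE.
have ci : c * below 0 < n.
  rewrite -width0 width_below // ltn_pmul2r ?below_gt0 //.
  by apply: leq_trans arity_le_width.
have := YT (Ordinal ci); rewrite /restrict /= mulnK ?below_gt0 //.
by rewrite valK.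
Qed.

End ChildPermutations.

Lemma fact_le_tree_symmetric m n h (k : 'I_h -> nat) (kn : \prod_j k j = n)
    (j0 : 'I_h) (C : circuit m n) (d e : nat) : 1 < m -> 0 < n ->
    symmetric_circuit (tree_aut_group kn) C -> computes_AND C ->
    0 < d -> 4 * e <= d -> 2 * (e * e) + 2 * e <= k j0 ->
    d + 3 * (m * d ^ size (primes m)) <= k j0 ->
  e`! <= circuit_size C.
Proof.
move=> m1 n0 Csym CAND d0 ed ek dk; apply: leq_trans (leq_addr _ _).
apply: (@fact_le_gates m n C _ _ (@restrict h n k j0) m1 _ _ _ Csym CAND d e) => //.
- exact: restrict_input.
- exact: restrict_sym.
- exact: restrict_AND.
- by rewrite card_ord.
rewrite card_ord; apply: leq_trans dk; rewrite leq_add2l leq_mul2l /=.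
by apply: modulus_le => //; apply: ltnW.
Qed.

(** * Conjunction as a combination of MOD gates *)

Lemma bin_leq_expn n j : 'C(n, j) <= n ^ j.
Proof.
apply: leq_trans (leq_pmulr _ (fact_gt0 j)) _; rewrite bin_ffact ffact_prod.
apply: (@leq_trans (\prod_(i < j) n)); last by rewrite prod_nat_const card_ord.
by apply: leq_prod => i _; apply: leq_subr.
Qed.

Lemma coprime_inverse_mod n p : 0 < n -> coprime n p ->
  exists u, u * n = 1 %[mod p].
Proof.
move=> n0 /(coprimeP _ n0)[[u v] /= uv]; exists u.
have -> : u * n = v * p + 1 by lia.
by rewrite modnMDl.
Qed.

Lemma dvdn_prod_pfactor (ps : seq nat) (e : nat -> nat) x :
  uniq ps -> all prime ps -> (forall p, p \in ps -> p ^ e p %| x) ->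
  \prod_(p <- ps) p ^ e p %| x.
Proof.
elim: ps => [|p ps IH] /=; first by rewrite big_nil.
case/andP=> pps ups /andP[pp pps'] H; rewrite big_cons Gauss_dvd.
  by rewrite H ?mem_head // IH // => q qps; apply: H; rewrite inE qps orbT.
rewrite big_seq; apply: (big_ind (fun y => coprime (p ^ e p) y)).
- exact: coprimen1.
- by move=> y z cy cz; rewrite coprimeMr cy.
move=> q qps; rewrite coprimeXl // coprimeXr // prime_coprime //.
by rewrite dvdn_prime2 ?(allP pps' q qps) //; apply: contraNneq pps => ->.
Qed.

Lemma all_prime_primes m : all prime (primes m).
Proof. by apply/allP => p; rewrite mem_primes => /andP[]. Qed.

Lemma size_primes_le m : size (primes m) <= m.
Proof.
rewrite -[leqRHS](size_iota 1); apply: uniq_leq_size (primes_uniq m) _ => p.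
rewrite mem_primes mem_iota add1n ltnS => /and3P[pp m0 pm].
by rewrite prime_gt0 // dvdn_leq.
Qed.

Lemma dvdn_cofactor m p q : p \in primes m -> q \in primes m -> q != p ->
  p ^ logn p m %| m %/ q.
Proof.
rewrite !mem_primes => /and3P[pp m0 pm] /and3P[qq _ qm] qp.
have : p ^ logn p m %| m %/ q * q by rewrite divnK // pfactor_dvdnn.
by rewrite Gauss_dvdl // coprimeXl // prime_coprime // dvdn_prime2 // eq_sym.
Qed.

Section Combinations.

Variables m k : nat.
Implicit Types (Y S : {set 'I_k}) (f : {set 'I_k} -> 'Z_m).
Local Open Scope ring_scope.

(* [(c, (a, A))] stands for [c] times the gate [MOD_m^A] with [a i] wires from
   the [i]-th input. *)
Definition weighted_gate : Type := 'Z_m * ({ffun 'I_k -> 'Z_m} * {set 'Z_m}).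

Definition gate_bit (g : weighted_gate) Y : bool := \sum_(i in Y) g.2.1 i \in g.2.2.

Definition combination (L : seq weighted_gate) Y : 'Z_m :=
  \sum_(g <- L) g.1 * (gate_bit g Y)%:R.

Definition representable N f : Prop :=
  exists2 L, (size L <= N)%N & forall Y, combination L Y = f Y.

Lemma eq_representable N f f' : f =1 f' -> representable N f -> representable N f'.
Proof. by move=> ff' [L sL Lf]; exists L => // Y; rewrite Lf. Qed.

Lemma representable_leq N N' f : (N <= N')%N -> representable N f -> representable N' f.
Proof. by move=> NN' [L sL Lf]; exists L => //; apply: leq_trans NN'. Qed.

Lemma representable_gate a (A : {set 'Z_m}) :
  representable 1 (fun Y => (\sum_(i in Y) a i \in A)%:R).
Proof.
exists [:: (1, (finfun a, A))] => // Y; rewrite /combination big_seq1 mul1r.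
by rewrite /gate_bit /=; under eq_bigr do rewrite ffunE.
Qed.

Lemma representableZ N c f : representable N f -> representable N (fun Y => c * f Y).
Proof.
case=> L sL Lf; exists [seq (c * g.1, g.2) | g <- L]; first by rewrite size_map.
by move=> Y; rewrite -Lf /combination big_map big_distrr; apply: eq_bigr => g _; rewrite /= -mulrA.
Qed.

Lemma representableD N N' f f' : representable N f -> representable N' f' ->
  representable (N + N') (fun Y => f Y + f' Y).
Proof.
move=> [L sL Lf] [L' sL' Lf']; exists (L ++ L'); first by rewrite size_cat leq_add.
by move=> Y; rewrite /combination big_cat /= -Lf -Lf'.
Qed.

Lemma representable_sum (I : eqType) (r : seq I) N (f : I -> {set 'I_k} -> 'Z_m) :
  (forall i, i \in r -> representable N (f i)) ->
  representable (size r * N) (fun Y => \sum_(i <- r) f i Y).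
Proof.
elim: r => [|i r IH] fN.
  by exists [::] => // Y; rewrite /combination !big_nil.
rewrite mulSn; apply: (@eq_representable _ (fun Y => f i Y + \sum_(i <- r) f i Y)).
  by move=> Y; rewrite big_cons.
apply: representableD; first by apply: fN; rewrite mem_head.
by apply: IH => j jr; apply: fN; rewrite inE jr orbT.
Qed.

Lemma representable_sum_card (I : finType) (P : pred I) N (f : I -> {set 'I_k} -> 'Z_m) :
  (forall i, P i -> representable N (f i)) ->
  representable (#|P| * N) (fun Y => \sum_(i | P i) f i Y).
Proof.
move=> fN; rewrite cardE.
apply: (@eq_representable _ (fun Y => \sum_(i <- enum P) f i Y)).
  by move=> Y; rewrite big_enum.
by apply: representable_sum => i; rewrite mem_enum; apply: fN.
Qed.

Hypothesis m1 : (1 < m)%N.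

Section CoprimeConjunction.

Variables p q : nat.
Hypotheses (p_pr : prime p) (q_pr : prime q) (pq : p != q).
Hypotheses (pm : (p %| m)%N) (qm : (q %| m)%N).

Let q1 : (1 < q)%N := prime_gt1 q_pr.

Lemma Zp_natr_modn (x : nat) : ((x %% m)%N%:R = x%:R :> 'Z_q).
Proof. by apply: Zp_nat_eqmod => //; rewrite modn_dvdm. Qed.

Let supported S : {set {ffun 'I_k -> 'Z_q}} :=
  [set a : {ffun 'I_k -> 'Z_q} | [forall i, (i \in S) || (a i == 0)]].

Lemma card_supported S : #|supported S| = (q ^ #|S|)%N.
Proof.
rewrite -[q in RHS](Zp_cast q1) -[(Zp_trunc q).+2 in RHS]card_ord.
rewrite -(card_pffun_on (0 : 'Z_q) S predT); apply: eq_card => a.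
rewrite inE; apply/forallP/pffun_onP => [aS|[/subsetP aS _] i].
  split=> //; apply/subsetP => i; rewrite inE => ai.
  by have := aS i; rewrite (negPf ai) orbF.
by rewrite orbC -implyNb; apply/implyP => ai; apply: aS; rewrite inE.
Qed.

(** Since [q] divides [m], the residue of a sum mod [q] can be read off from its residue mod [m]. *)
Lemma representable_Zq_test (a : {ffun 'I_k -> 'Z_q}) (b : 'Z_q) :
  representable 1 (fun Y => (\sum_(i in Y) a i == b)%:R).
Proof.
apply: eq_representable (representable_gate (fun i => (nat_of_ord (a i))%:R)
  [set z : 'Z_m | (nat_of_ord z)%:R == b]) => Y.
rewrite inE -natr_sum val_Zp_nat // Zp_natr_modn natr_sum.
by congr (nat_of_bool (_ == _))%:R; apply: eq_bigr => i _; rewrite natr_Zp.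
Qed.

(* Adding the indicator of a point of [Y :&: S] shifts the inner sum by 1, so
   the difference vanishes unless [Y] and [S] are disjoint. *)
Lemma sum_supported S Y :
  \sum_(a in supported S) ((\sum_(i in Y) a i == 0)%:R - (\sum_(i in Y) a i == 1)%:R)
    = (q ^ #|S|)%N%:R * [disjoint Y & S]%:R :> 'Z_m.
Proof.
have [YS|] := boolP [disjoint Y & S].
  rewrite mulr1 -card_supported -sum1_card natr_sum; apply: eq_bigr => a.
  rewrite inE => /forallP aS; rewrite big1 ?eqxx => [|i iY]; last first.
    by have := aS i; rewrite (disjointFr YS iY) => /eqP.
  by rewrite eq_sym oner_eq0 subr0.
case/pred0Pn => i /andP[/= iY iS]; rewrite mulr0 sumrB; apply/eqP; rewrite subr_eq0; apply/eqP.
pose delta : {ffun 'I_k -> 'Z_q} := [ffun j => (j == i)%:R].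
rewrite [RHS](reindex_inj (addIr delta)); apply: eq_big => a.
  rewrite !inE; apply: eq_forallb => j; rewrite !ffunE.
  by have [->|] := eqVneq j i; [rewrite iS | rewrite addr0].
move=> _; congr (nat_of_bool _)%:R.
under [in RHS]eq_bigr do rewrite !ffunE.
rewrite big_split /= [X in _ + X](bigD1 i) //= eqxx.
rewrite [X in _ + (_ + X)]big1 => [|j /andP[_ /negPf->]] //.
by rewrite addr0 -[in RHS]subr_eq0 addrK.
Qed.

(** The factor [m %/ p] is what allows arithmetic mod [p] inside ['Z_m]. *)
Lemma mul_cofactor_eqmod x y : x = y %[mod p] ->
  ((m %/ p)%N%:R * x%:R = (m %/ p)%N%:R * y%:R :> 'Z_m).
Proof.
move=> xy; rewrite -!natrM; apply: Zp_nat_eqmod => //.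
by rewrite -{2 4}(divnK pm) -!muln_modr xy.
Qed.

(** [q ^ #|S|] is invertible mod [p], so in the presence of the factor [m %/ p] it can be divided
    out of [sum_supported]. *)
Lemma representable_disjoint S :
  representable (2 * q ^ #|S|) (fun Y => (m %/ p)%N%:R * [disjoint Y & S]%:R).
Proof.
have cop : coprime (q ^ #|S|) p by rewrite coprimeXl // prime_coprime // dvdn_prime2 // eq_sym.
have [u uE] : exists u, (u * q ^ #|S| = 1 %[mod p])%N.
  by apply: coprime_inverse_mod; rewrite // expn_gt0 ltnW.
apply: (@eq_representable _ (fun Y => ((m %/ p)%N%:R * u%:R) *
   \sum_(a in supported S)
      ((\sum_(i in Y) a i == 0)%:R - (\sum_(i in Y) a i == 1)%:R))) => [Y|].
  rewrite sum_supported mulrA; congr (_ * _); rewrite -mulrA -natrM.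
  by rewrite (mul_cofactor_eqmod uE) mulr1.
apply: representableZ; rewrite mulnC -card_supported.
apply: representable_sum_card => a _.
apply: (@eq_representable _ (fun Y => (\sum_(i in Y) a i == 0)%:R + -1 * (\sum_(i in Y) a i == 1)%:R)).
  by move=> Y; rewrite mulN1r.
by apply: (@representableD 1 1); [|apply: representableZ]; apply: representable_Zq_test.
Qed.

(** Vandermonde's identity expands the binomial in the ['C(#|~: Y|, j)] with [j < Q], each of which
    counts the [j]-subsets disjoint from [Y]. *)
Lemma representable_bin Q : (0 < k)%N -> (0 < Q)%N ->
  representable (Q * (k ^ Q * (2 * m ^ Q)))
    (fun Y => (m %/ p)%N%:R * 'C(#|~: Y| + Q.-1, Q.-1)%:R).
Proof.
move=> k0 Q0; rewrite -[X in (X * _)%N](card_ord Q).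
apply: (@eq_representable _ (fun Y => \sum_(j < Q) 'C(Q.-1, Q.-1 - j)%:R *
   \sum_(S : {set 'I_k} | #|S| == j) (m %/ p)%N%:R * [disjoint Y & S]%:R)).
  move=> Y; rewrite -binomial.Vandermonde prednK // natr_sum big_distrr /=.
  apply: eq_bigr => j _; rewrite natrM mulrC -big_distrr /= -mulrA.
  congr (_ * (_ * _)); rewrite -cards_draws -sum1_card natr_sum big_mkcond [RHS]big_mkcond /=.
  by apply: eq_bigr => S _; rewrite inE disjoint_sym disjoints_subset; case: (_ \subset _); case: eqP.
apply: representable_sum_card => j _; apply: representableZ.
apply: (@representable_leq (#|[pred S : {set 'I_k} | #|S| == j]| * (2 * m ^ Q))); last first.
  apply: representable_sum_card => S /eqP cS; apply: representable_leq (representable_disjoint S).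
  rewrite leq_mul2l /= cS; apply: (@leq_trans (m ^ j)).
    have [->//|j0] := posnP j; rewrite leq_exp2r //.
    by apply: dvdn_leq => //; apply: ltnW.
  by rewrite leq_exp2l // ltnW.
rewrite leq_mul2r; apply/orP; right.
rewrite (_ : #|_| = 'C(k, j)); last first.
  by rewrite -[k in RHS]card_ord -card_draws cardsE.
by apply: leq_trans (bin_leq_expn _ _) _; rewrite leq_pexp2l // ltnW.
Qed.

End CoprimeConjunction.

Let Q d p := (p ^ (trunc_log p d).+1)%N.

(** If [Y] misses [s > 0] points, then [s <= k] is smaller than the product of the [Q d p], so some
    [Q d p] does not divide [s], and [p] divides its binomial. Mod [p ^ logn p m] only the summand
    of [p] survives on either side: it is 0 on the left, but [m %/ p] is not 0. *)
Lemma AND_test d Y : (k < d ^ size (primes m))%N -> (0 < d)%N ->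
  (\sum_(p <- primes m) (m %/ p)%N%:R * 'C(#|~: Y| + (Q d p).-1, (Q d p).-1)%:R
   == \sum_(p <- primes m) (m %/ p)%N%:R :> 'Z_m) = (Y == setT).
Proof.
move=> kd d0; apply/idP/eqP => [|->]; last first.
  apply/eqP/eq_bigr => p _; rewrite setCT cards0 add0n binn mulr1 //.
set s := #|~: Y|; move=> E.
suff : (s == 0)%N by rewrite cards_eq0 => /eqP Y0; rewrite -[Y]setCK Y0 setC0.
apply: contraTT E => s0.
have [p pm ps] : exists2 p, p \in primes m & ~~ (Q d p %| s)%N.
  apply/hasP; rewrite has_predC; apply: contra s0 => /allP sP.
  have dv : (\prod_(p <- primes m) Q d p %| s)%N.
    exact: (dvdn_prod_pfactor (e := fun p => (trunc_log p d).+1) (primes_uniq m) (all_prime_primes m) sP).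
  rewrite -leqn0 leqNgt; apply/negP => s1.
  have := dvdn_leq s1 dv; rewrite leqNgt => /negP; apply.
  apply: (@leq_ltn_trans k); first by rewrite -[leqRHS]card_ord max_card.
  apply: leq_trans kd _; rewrite -iter_muln_1 -count_predT -big_const_seq.
  rewrite !(big_seq _ _ (primes m)) big_mkcond [leqRHS]big_mkcond /=.
  apply: leq_prod => p _; case: ifP => // /[!mem_primes] /and3P[pp _ _].
  by rewrite ltnW // trunc_log_ltn // prime_gt1.
have := pm; rewrite mem_primes => /and3P[pp m0 pdm].
apply/negP => /eqP.
have -> : \sum_(q <- primes m) (m %/ q)%N%:R * 'C(s + (Q d q).-1, (Q d q).-1)%:R
    = (\sum_(q <- primes m) m %/ q * 'C(s + (Q d q).-1, (Q d q).-1))%N%:R :> 'Z_m.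
  by rewrite natr_sum; apply: eq_bigr => q _; rewrite natrM.
rewrite -natr_sum => /(congr1 (@nat_of_ord _)); rewrite !val_Zp_nat // => /eqP E.
have Pm : (p ^ logn p m %| m)%N by rewrite pfactor_dvdnn.
have {}E : (\sum_(q <- primes m) m %/ q * 'C(s + (Q d q).-1, (Q d q).-1)
    = \sum_(q <- primes m) m %/ q %[mod p ^ logn p m])%N.
  by rewrite -(modn_dvdm _ Pm) (eqP E) modn_dvdm.
move: E; rewrite !(big_rem p pm) /=.
have rest (F : nat -> nat) : (p ^ logn p m %| \sum_(q <- rem p (primes m)) m %/ q * F q)%N.
  rewrite big_seq; apply: dvdn_sum => q; rewrite (mem_rem_uniq _ (primes_uniq m)) inE.
  by case/andP=> qp qm; rewrite dvdn_mulr // dvdn_cofactor.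
rewrite -modnDmr (eqP (rest _)) addn0.
under [X in (_ = _ + X %[mod _])%N]eq_bigr do rewrite -[(m %/ _)%N]muln1.
rewrite -[in RHS]modnDmr (eqP (rest (fun=> 1%N))) addn0 => E.
have /dvdnP[w wE] : (p %| 'C(s + (Q d p).-1, (Q d p).-1))%N.
  have := @dvdn_bin_pfactor p pp 1 (trunc_log p d) (s + Q d p).
  rewrite dvdn_addl // add1n -/(Q d p) => /(_ ps).
  rewrite expn1 (_ : (s + Q d p).-1 = s + (Q d p).-1)%N //.
  by rewrite -[in LHS](prednK (_ : 0 < Q d p)%N) ?expn_gt0 ?prime_gt0 // addnS.
have : (p ^ logn p m %| m %/ p)%N.
  rewrite /dvdn -E wE mulnCA divnK // -/(dvdn _ _); apply: dvdn_mull.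
  by rewrite pfactor_dvdnn.
rewrite dvdn_divRL // -expnSr pfactor_dvdn // ltnn //.
Qed.

Lemma representable_AND d : (1 < size (primes m))%N -> (0 < d)%N -> (0 < k)%N ->
    (k < d ^ size (primes m))%N ->
  exists L c, (size L <= m * (m * d * (k ^ (m * d) * (2 * m ^ (m * d)))))%N /\
    forall Y, (combination L Y == c) = (Y == setT).
Proof.
move=> r2 d0 k0 kd.
have : representable (size (primes m) * (m * d * (k ^ (m * d) * (2 * m ^ (m * d)))))
    (fun Y => \sum_(p <- primes m) (m %/ p)%N%:R * 'C(#|~: Y| + (Q d p).-1, (Q d p).-1)%:R).
  apply: representable_sum => p pm.
  have := pm; rewrite mem_primes => /and3P[pp m0 pdm].
  have [q qm qp] : exists2 q, q \in primes m & p != q.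
    apply/hasP; apply/negPn; rewrite -all_predC; apply/negP => /allP H.
    have := uniq_leq_size (primes_uniq m) (_ : {subset primes m <= [:: p]}).
    rewrite leqNgt r2 => F; suff: false by []; apply: F => q /H /=.
    by rewrite negbK inE eq_sym.
  have := qm; rewrite mem_primes => /and3P[qq _ qdm].
  have Q0 : (0 < Q d p)%N by rewrite expn_gt0 prime_gt0.
  have QM : (Q d p <= m * d)%N.
    by rewrite /Q expnS; apply: leq_mul; [apply: dvdn_leq | apply: trunc_logP => //; apply: prime_gt1].
  apply: representable_leq (representable_bin pp qq qp pdm qdm k0 Q0).
  by rewrite !leq_mul // leq_pexp2l // ltnW.
case=> L sL LE; exists L, (\sum_(p <- primes m) (m %/ p)%N%:R); split.
  apply: leq_trans sL _; rewrite leq_mul2r; apply/orP; right.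
  exact: size_primes_le.
by move=> Y; rewrite LE AND_test.
Qed.

End Combinations.

(** * Composition of circuits *)

Section Compose.

Variables (m k n : nat) (C : circuit m n) (L : seq (weighted_gate m k)) (c : 'Z_m).
Hypotheses (m1 : 1 < m) (k0 : 0 < k).
Hypothesis C_AND : computes_AND C.
Hypothesis L_AND : forall Y, (combination L Y == c) = (Y == setT).

(** One output gate, a middle gate for each member of [L], and [k] copies of [C], the [i]-th of
    which feeds the [i]-th input of the middle gates. *)
Let gateT : finType := (unit + ('I_(size L) + 'I_k * gate C))%type.
Let lgate (l : 'I_(size L)) : weighted_gate m k := tnth (in_tuple L) l.

(* Adding [m] to every multiplicity changes no sum mod [m] and ensures that the
   new gates have children even where a coefficient is 0. *)
Definition compose_wires (g h : gateT) : nat :=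
  match g, h with
  | inl _, inr (inl l) => m + (lgate l).1
  | inr (inl l), inr (inr (i, g')) =>
      if g' == output C then m + (lgate l).2.1 i else 0
  | inr (inr (i, g')), inr (inr (j, h')) => if i == j then wires g' h' else 0
  | _, _ => 0
  end.

Definition compose_label (g : gateT) : gate_label m (k * n) :=
  match g with
  | inl _ => Mod _ [set c]
  | inr (inl l) => Mod _ (lgate l).2.2
  | inr (inr (i, g')) =>
      match label g' with
      | Input j => Input m (mxvec_index i j)
      | Mod A => Mod _ A
      end
  end.

Let e : rel gateT := fun g h => 0 < compose_wires g h.

Lemma m_gt0 : 0 < m. Proof. exact: ltnW. Qed.

Lemma size_L_gt0 : 0 < size L.
Proof.
rewrite lt0n; apply/negP => /nilP L0.
have := L_AND set0; have := L_AND setT; rewrite L0 /combination !big_nil eqxx => ->.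
by move/esym/eqP/setP/(_ (Ordinal k0)); rewrite !inE.
Qed.

(** The output is a child of no gate, and middle gates are children of the output only, so a cycle
    stays within the copies and projects to a cycle of [C]. *)
Lemma compose_acyclic (p : seq gateT) : path.cycle e p -> p = [::].
Proof.
move=> ep; pose f (g : gateT) := if g is inr (inr (_, g')) then g' else output C.
pose P (g : gateT) := if g is inr (inr _) then true else false.
have Pp : all P p.
  apply/allP => g gp; have := prev_cycle ep gp.
  case: g gp => [[]|[l|//]] gp; rewrite /e /=.
    by case: (prev _ _) => [[]|[?|[? ?]]].
  case E : (prev _ _) => [[]|[?|[? ?]]] // _.
  have up : inl tt \in p by rewrite -E mem_prev.
  have := prev_cycle ep up.
  by rewrite /e /=; case: (prev _ _) => [[]|[?|[? ?]]].
have : path.cycle (@edge m n C) [seq f g | g <- p].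
  apply: (homo_cycle_in (P := P)) Pp ep => -[[]|[?|[i g]]] [[]|[?|[j h]]] // _ _.
  by rewrite /e /edge /=; case: (i == j).
by move/circuit_acyclic; case: p {ep Pp}.
Qed.

Lemma compose_inputs g :
  is_input (compose_label g) = [forall h, compose_wires g h == 0].
Proof.
have m0 := m_gt0.
case: g => [[]|[l|[i g]]] /=.
- apply/esym/negP => /forallP/(_ (inr (inl (Ordinal size_L_gt0)))) /=.
  by rewrite addn_eq0 eqn0Ngt m0.
- apply/esym/negP => /forallP/(_ (inr (inr (Ordinal k0, output C)))) /=.
  by rewrite eqxx addn_eq0 eqn0Ngt m0.
have -> : is_input match label g with
    | Input j => Input m (mxvec_index i j) | Mod A => Mod _ A end = is_input (label g).
  by case: (label g).
rewrite circuit_inputs; apply/forallP/forallP => H.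
  by case=> [[]|[l|[j h]]] //=; case: (i == j) => //; apply: H.
by move=> h; have := H (inr (inr (i, h))); rewrite /= eqxx.
Qed.

Lemma compose_variables i : exists! g, compose_label g = Input m i.
Proof.
case/mxvec_indexP: i => i j; have [g [gj gu]] := circuit_variables C j.
exists (inr (inr (i, g))); split; first by rewrite /= gj.
case=> [[]|[l|[i' g']]] //=; case E : (label g') => [j'|A] //.
move/(congr1 (fun l => if l is Input z then z else mxvec_index i j)) => /= ij.
have [f fK _] := curry_mxvec_bij k n.
have [ii jj] : (i', j') = (i, j).
  by apply: (can_inj (g := f) _); [move=> x; apply: fK | exact: ij].
by rewrite ii (gu g') // E jj.
Qed.

Definition compose : circuit m (k * n) :=
  @Circuit m (k * n) gateT compose_wires compose_label (inl tt)
    compose_acyclic compose_inputs compose_variables.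

Lemma natr_addm (x : nat) : ((m + x)%:R = x%:R :> 'Z_m)%R.
Proof. by apply: Zp_nat_eqmod => //; rewrite modnDl. Qed.

(** The intended values satisfy the local equation at every gate, so they are the values by
    [eval_unique]. *)
Lemma compose_AND : computes_AND compose.
Proof.
move=> x; pose xi i j := x (mxvec_index i j).
pose Y := [set i | [forall j, xi i j]].
pose v (g : gateT) := match g with
  | inl _ => [forall i, x i]
  | inr (inl l) => gate_bit (lgate l) Y
  | inr (inr (i, g')) => eval (xi i) g'
  end.
suff vE g : v g = gate_value (C := compose) x v g.
  by rewrite -(@eval_unique _ _ compose x v).
have sumE (F : gateT -> nat) : \sum_h F h =
    F (inl tt) + (\sum_l F (inr (inl l)) + \sum_i \sum_g' F (inr (inr (i, g')))).
  rewrite big_sumType /= (big_pred1 tt) => [|[]] //; congr (_ + _).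
  by rewrite big_sumType /= pair_bigA; congr (_ + _); apply: eq_bigr => -[].
rewrite /gate_value; case: g => [[]|[l|[i g]]] /=.
- rewrite sumE /= mul0n add0n.
  rewrite [X in _ + X]big1 ?addn0 => [|i _]; last by rewrite big1.
  rewrite natr_sum inE (eq_bigr (fun l => (lgate l).1 * (gate_bit (lgate l) Y)%:R)%R); last first.
    by move=> l _; rewrite natrM natr_addm natr_Zp.
  rewrite -(big_tuple _ _ _ predT (fun g => g.1 * (gate_bit g Y)%:R)%R) /= L_AND.
  apply/forallP/eqP => [xT|YT i].
    by apply/setP => i; rewrite !inE; apply/forallP => j; apply: xT.
  case/mxvec_indexP: i => i j.
  by have /setP/(_ i) := YT; rewrite !inE => /forallP/(_ j).
- rewrite sumE /= mul0n add0n big1 // add0n.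
  rewrite natr_sum /gate_bit big_mkcond /=; apply: (congr1 (fun z : 'Z_m => z \in (lgate l).2.2)).
  apply: eq_bigr => i _.
  rewrite (bigD1 (output C)) //= eqxx big1 ?addn0 => [|g /negPf->] //.
  rewrite natrM natr_addm natr_Zp C_AND inE; case: ifP => _; by rewrite ?mulr1 ?mulr0.
rewrite [LHS]evalE /gate_value; case: (label g) => // A.
rewrite sumE /= mul0n add0n [\sum_(l < size L) _]big1 // add0n (bigD1 i) //= eqxx.
rewrite [X in _ + X]big1 ?addn0 // => j ji; rewrite big1 // => h _.
by rewrite eq_sym (negPf ji).
Qed.

Lemma compose_depth d : is_depth C d -> is_depth compose d.+2.
Proof.
case=> -[p /andP[pp pin] sp] dmax.
have inrP i (q : seq gateT) g : path e (inr (inr (i, g))) q ->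
    exists2 q', q = [seq inr (inr (i, g')) | g' <- q'] & path (@edge m n C) g q'.
  elim: q g => [|[[]|[l|[j g']]] q IH] g //=; first by exists [::].
  case/andP; rewrite {1}/e /=; case: eqP => // <- gg' /IH[q' -> q'P].
  by exists (g' :: q'); rewrite //= q'P andbT.
have inputE i g : is_input (compose_label (inr (inr (i, g)))) = is_input (label g).
  by rewrite /=; case: (label g).
split.
  exists [:: inr (inl (Ordinal size_L_gt0)), inr (inr (Ordinal k0, output C)) &
    [seq inr (inr (Ordinal k0, g)) | g <- p]]; last by rewrite /= size_map sp.
  apply/andP; split; last by rewrite /= last_map inputE.
  have m0 := m_gt0.
  rewrite /= {1 2}/edge /= eqxx !addn_gt0 m0 /= path_map.
  by apply: sub_path pp => g h.
move=> q /andP[/= qp qin].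
case: q qp qin => [|[[]|[l|[i g]]] q] //= /andP[_].
case: q => [|[[]|[l'|[i g]]] q] //= /andP[]; rewrite {1}/edge /=.
case: eqP => // -> _ /inrP[q' -> q'P].
rewrite last_map inputE size_map !ltnS => q'in.
by apply: dmax; apply/andP.
Qed.

Lemma compose_size : circuit_size compose <=
  k * circuit_size C + (1 + size L * (1 + 2 * m + 2 * m * k)).
Proof.
have sumE (F : gateT -> nat) : \sum_h F h =
    F (inl tt) + (\sum_l F (inr (inl l)) + \sum_i \sum_g' F (inr (inr (i, g')))).
  rewrite big_sumType /= (big_pred1 tt) => [|[]] //; congr (_ + _).
  by rewrite big_sumType /= pair_bigA; congr (_ + _); apply: eq_bigr => -[].
have Zm (z : 'Z_m) : m + z <= 2 * m.
  by rewrite mul2n -addnn leq_add2l -[leqRHS](Zp_cast m1) ltnW.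
rewrite /circuit_size /= /gateT !card_sum card_unit card_prod !card_ord.
rewrite sumE sumE /= add0n.
have sum_const_le x (F : 'I_x -> nat) b :
    (forall i, F i <= b) -> \sum_(i < x) F i <= x * b.
  move=> Fb; apply: (@leq_trans (\sum_(i < x) b)); first exact: leq_sum.
  by rewrite sum_nat_const card_ord.
have H1 : \sum_(l < size L) (m + (lgate l).1) <= size L * (2 * m).
  exact: sum_const_le.
rewrite [\sum_(i < k) \sum_g' 0]big1 ?addn0 => [|i _]; last by rewrite big1.
set S3 := \sum_(l < size L) \sum_h _; set S4 := \sum_(i < k) _.
have H3 : S3 <= size L * (2 * m * k).
  apply: (sum_const_le) => l.
  rewrite sumE /= add0n big1 // add0n [leqRHS]mulnC.
  apply: sum_const_le => i; rewrite (bigD1 (output C)) //= eqxx.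
  by rewrite big1 ?addn0 // => g /negPf->.
have H4 : S4 = k * \sum_g \sum_h wires (c := C) g h.
  rewrite -[k in RHS]card_ord -sum_nat_const; apply: eq_bigr => i _.
  apply: eq_bigr => g _; rewrite sumE /= add0n big1 // add0n (bigD1 i) //= eqxx.
  rewrite [X in _ + X]big1 ?addn0 // => j ji; rewrite big1 // => h _.
  by rewrite eq_sym (negPf ji).
rewrite H4; move: H1 H3; set S1 := \sum_(l < size L) (m + _).
clearbody S1 S3; clear.
by rewrite !mulnDr muln1; move: (size L) => l; lia.
Qed.

End Compose.

Lemma input_circuit m : exists C : circuit m 1,
  [/\ is_depth C 0, computes_AND C & circuit_size C = 1].
Proof.
have acyc (p : seq unit) : path.cycle (fun g h => 0 < 0) p -> p = [::].
  by case: p => // x p; rewrite /= rcons_path andbF.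
have inp (g : unit) : is_input (Input m (ord0 : 'I_1)) = [forall h : unit, 0 == 0].
  by apply/esym/forallP.
have var (i : 'I_1) : exists! g : unit, Input m (ord0 : 'I_1) = Input m i.
  by exists tt; split=> [|[]] //; rewrite (ord1 i).
pose C := @Circuit m 1 unit (fun _ _ => 0) (fun=> Input m ord0) tt acyc inp var.
exists C; split.
- by split; [exists [::] | case=> // g p /andP[]].
- move=> x; rewrite evalE /gate_value /=.
  by apply/idP/forallP => [x0 i|->] //; rewrite (ord1 i).
- by rewrite /circuit_size /= card_unit big1 // => g _; rewrite big1.
Qed.

(** Each level multiplies the size by at most [K + W]: at most [K] copies of the circuit built so
    far, and at most [W] new gates and wires. *)
Lemma AND_circuit m d K W h (k : 'I_h -> nat) : 1 < size (primes m) -> 0 < d ->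
    K < d ^ size (primes m) -> (forall i, 0 < k i <= K) ->
    1 + m * (m * d * (K ^ (m * d) * (2 * m ^ (m * d)))) * (1 + 2 * m + 2 * m * K) <= W ->
  exists C : circuit m (\prod_i k i),
    [/\ is_depth C (2 * h), computes_AND C & circuit_size C <= (K + W) ^ h].
Proof.
move=> r2 d0 Kd kK WE; have m1 : 1 < m by apply: leq_trans r2 (size_primes_le m).
elim: h k kK => [|h IH] k kK.
  by rewrite big_ord0; have [C [? ? sC]] := input_circuit m; exists C; rewrite sC.
rewrite big_ord_recl.
have [C [depC andC sC]] := IH (fun i => k (lift ord0 i)) (fun i => kK _).
have /andP[k0 k0K] := kK ord0.
have [L [c [sL LE]]] := representable_AND m1 r2 d0 k0 (leq_ltn_trans k0K Kd).
exists (compose C m1 k0 LE); split.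
- by rewrite mulnS; apply: compose_depth.
- exact: compose_AND.
apply: leq_trans (compose_size _ _ _ _) _.
rewrite expnS mulnDl; apply: leq_add; first exact: leq_mul.
apply: (@leq_trans W); last first.
  by rewrite leq_pmulr // expn_gt0; move: WE; case: (W) => [|w _]; rewrite ?addnS.
apply: leq_trans WE; rewrite leq_add2l; apply: leq_mul; last first.
  by rewrite leq_add2l leq_mul2l k0K orbT.
apply: leq_trans sL _; rewrite leq_mul2l; apply/orP; right.
rewrite leq_mul2l; apply/orP; right; rewrite leq_mul2r; apply/orP; right.
by rewrite leq_exp2r // muln_gt0 d0 andbT ltnW.
Qed.

(** * Asymptotics *)

Import Order.TTheory GRing.Theory Num.Theory.

(** The factors of the two factorials are paired in opposite order: [i.+1 * (e - i) >= e]. *)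
Lemma expn_le_fact_sqr e : e ^ e <= e`! * e`!.
Proof.
have -> : e`! = \prod_(i < e) i.+1 by rewrite fact_prod big_add1 /= big_mkord.
rewrite {2}(reindex_inj rev_ord_inj) /= -big_split /=.
apply: (@leq_trans (\prod_(i < e) e)); first by rewrite prod_nat_const card_ord.
apply: leq_prod => i _; have := ltn_ord i; nia.
Qed.

(** [e] is the largest number with [4 * m * (4 * e) ^ r <= K]; the bound on [K] says that [32 * m]
    qualifies. Of the four summands [m * (4 * e) ^ r], three are kept and the fourth dominates
    [4 * e]. *)
Lemma lower_parameter m r K : 0 < m -> 2 <= r -> 4 * m * (128 * m) ^ r <= K ->
  exists e, [/\ 32 * m <= e, 2 * (e * e) + 2 * e <= K,
    4 * e + 3 * (m * (4 * e) ^ r) <= K & K < 4 * m * (4 * e.+1) ^ r].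
Proof.
move=> m0 r2 mK; pose P e := 4 * m * (4 * e) ^ r <= K.
have r0 : 0 < r by apply: leq_trans r2.
have P0 : exists e, P e by exists (32 * m); rewrite /P mulnA.
have Pmax e : P e -> e <= K.
  move=> /(leq_trans _); apply; apply: (@leq_trans (4 * e)); first by rewrite leq_pmull.
  apply: (@leq_trans ((4 * e) ^ r)); last by rewrite leq_pmull // muln_gt0.
  by case: (posnP e) => [->//|e0]; rewrite -{1}[4 * e]expn1 leq_pexp2l // muln_gt0.
case: (ex_maxnP P0 Pmax) => e Pe emax; exists e.
have e1 : 32 * m <= e by apply: emax; rewrite /P mulnA.
have e0 : 0 < e by apply: leq_trans e1; rewrite muln_gt0.
have e4 : (4 * e) ^ 2 <= (4 * e) ^ r by rewrite leq_pexp2l // muln_gt0.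
have me : (4 * e) ^ r <= m * (4 * e) ^ r by rewrite leq_pmull.
move: Pe; rewrite /P -mulnA => Pe.
split=> //.
- apply: leq_trans Pe; apply: (@leq_trans (4 * (4 * e) ^ 2)); first by nia.
  by rewrite leq_mul2l /= (leq_trans e4).
- apply: leq_trans Pe; rewrite -[4 * (m * _)]/(4.-1.+1 * _) mulSn leq_add2r.
  apply: leq_trans me; apply: leq_trans e4; nia.
- by rewrite ltnNge; apply/negP => /emax; rewrite ltnn.
Qed.

Lemma upper_parameter r K : 0 < r -> 0 < K -> exists d, K < d.+1 ^ r /\ d ^ r <= K.
Proof.
move=> r0 K0; pose P d := d ^ r <= K.
have P0 : exists d, P d by exists 0; rewrite /P exp0n.
have Pmax d : P d -> d <= K.
  by apply: leq_trans; case: d => // d; rewrite -{1}[d.+1]expn1 leq_pexp2l.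
case: (ex_maxnP P0 Pmax) => d Pd dmax; exists d; split=> //.
by rewrite ltnNge; apply/negP => /dmax; rewrite ltnn.
Qed.

(** With [D = m * d], both [D] and [m ^ D] are at most [K ^ D], [2 * m] is at most [K ^ 2] and the
    last factor at most [K ^ 3]. This makes [K ^ (3 * D + 5)]; the added terms cost one more factor
    [K], and [3 * D + 6 <= 5 * D]. *)
Lemma upper_size m d K : 6 <= m -> 0 < d -> m <= K ->
  K + (1 + m * (m * d * (K ^ (m * d) * (2 * m ^ (m * d)))) * (1 + 2 * m + 2 * m * K))
    <= K ^ (5 * (m * d)).
Proof.
move=> m6 d0 mK; set D := m * d.
have D6 : 6 <= D by apply: (@leq_trans m) => //; rewrite leq_pmulr.
have K6 : 6 <= K by apply: leq_trans mK.
have K0 : 0 < K by apply: leq_trans K6.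
have DK : D <= K ^ D by rewrite ltnW // ltn_expl // (leq_trans _ K6).
have mD : m ^ D <= K ^ D by rewrite leq_exp2r // (leq_trans _ D6).
have KD0 : 0 < K ^ D by rewrite expn_gt0 K0.
have c4 : 1 + 2 * m + 2 * m * K <= K ^ 3.
  by rewrite !expnS expn0 muln1; nia.
have main : m * (D * (K ^ D * (2 * m ^ D))) * (1 + 2 * m + 2 * m * K)
    <= K ^ (D + D + D + 5).
  rewrite !expnD (_ : K ^ 5 = K * K * K ^ 3); last by rewrite !expnS !expn0; nia.
  rewrite [leqRHS]mulnA; apply: leq_mul => //.
  have -> : m * (D * (K ^ D * (2 * m ^ D))) = D * K ^ D * m ^ D * (m * 2).
    by clearbody D; clear; move: (K ^ D) (m ^ D) => a b; lia.
  apply: leq_mul; last by nia.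
  by rewrite !leq_mul.
apply: (@leq_trans (K ^ (D + D + D + 5) + K ^ (D + D + D + 5))).
  rewrite addnA; apply: leq_add main.
  rewrite (_ : _ + 5 = (D + D + D + 3).+2) 2?expnS; last by lia.
  rewrite (_ : K * (K * K ^ (D + D + D + 3)) = K * K * K ^ (D + D + D + 3)) ?mulnA //.
  apply: (@leq_trans (K * K)); last by rewrite leq_pmulr // expn_gt0 K0.
  nia.
rewrite addnn -mul2n; apply: (@leq_trans (K ^ (D + D + D + 6))).
  by rewrite !addnS expnS leq_mul2r (leq_trans _ K6) // orbT.
by rewrite leq_pexp2l //; lia.
Qed.

Lemma kmax_gt (h : nat) (k : 'I_h -> nat) K0 :
  K0 ^ h < \prod_i k i -> K0 < \max_i k i.
Proof.
rewrite !ltnNge; apply: contra => kK.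
apply: (@leq_trans (\prod_(i < h) K0)); last by rewrite prod_nat_const card_ord.
by apply: leq_prod => i _; apply: leq_trans (leq_bigmax i) kK.
Qed.

Section Asymptotics.
Local Open Scope ring_scope.
Variable R : realType.
Variables r K : nat.
Hypotheses (r0 : (0 < r)%N) (K0 : (0 < K)%N).
Let x : R := K%:R `^ r%:R^-1.

Lemma root_ge0 : 0 <= x. Proof. exact: powR_ge0. Qed.

Lemma rootX : x ^+ r = K%:R.
Proof.
rewrite -powR_mulrn ?root_ge0 // -powRrM mulVf ?powRr1 //.
by rewrite pnatr_eq0 -lt0n.
Qed.

Lemma le_root (d : nat) : (d ^ r <= K)%N -> d%:R <= x.
Proof.
move=> dK; rewrite -(ler_pXn2r r0) ?nnegrE ?root_ge0 //.
by rewrite rootX -natrX ler_nat.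
Qed.

Lemma root_le (d : nat) : (K <= d ^ r)%N -> x <= d%:R.
Proof.
move=> dK; rewrite -(ler_pXn2r r0) ?nnegrE ?root_ge0 //.
by rewrite rootX -natrX ler_nat.
Qed.

Lemma root_ge1 : 1 <= x.
Proof. by have := @le_root 1; rewrite exp1n; apply. Qed.

Lemma ln_root : ln K%:R = r%:R * ln x :> R.
Proof. by rewrite -rootX lnXn ?mulr_natl // (lt_le_trans ltr01 root_ge1). Qed.

Lemma ln2_gt0 : 0 < ln (2 : R).
Proof. by rewrite ln_gt0 // ltr1n. Qed.

Lemma ln2_le1 : ln (2 : R) <= 1.
Proof. by have := @le_ln1Dx R 1; apply; lra. Qed.

Lemma powR2E (y : R) : 2 `^ y = expR (y * ln 2).
Proof. by rewrite /powR pnatr_eq0. Qed.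

(** The upper bound on [K] gives [x <= 32 * m * e <= e ^ 2], hence [ln x <= 2 * ln e]. With
    [ln K = r * ln x] and [e * ln e <= 2 * ln e!] this yields [x * ln K <= 128 * m * r * ln e!]. *)
Lemma powR2_le_fact m e : (0 < m)%N -> (32 * m <= e)%N ->
    (K < 4 * m * (4 * e.+1) ^ r)%N ->
  2 `^ ((128 * m * r)%:R^-1 * (x * ln K%:R)) <= e`!%:R.
Proof.
move=> m0 me Ke; have e0 : (0 < e)%N by apply: leq_trans me; rewrite muln_gt0.
have x1 := root_ge1; have x0 := root_ge0.
have xe : x <= (32 * m * e)%:R.
  apply: root_le; apply: leq_trans (ltnW Ke) _.
  apply: (@leq_trans ((4 * m) ^ r * (4 * e.+1) ^ r)).
    rewrite leq_mul2r; apply/orP; right; rewrite -{1}[(4 * m)%N]expn1 leq_pexp2l //.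
    by rewrite muln_gt0.
  by rewrite -expnMn leq_exp2r //; nia.
have eR : 1 <= e%:R :> R by rewrite ler1n.
have le0 : 0 <= ln (e%:R : R) by rewrite ln_ge0.
have lx : ln x <= 2 * ln e%:R.
  rewrite mulr_natl -lnXn ?(lt_le_trans ltr01) // ler_ln ?posrE ?(lt_le_trans ltr01) //.
    by apply: le_trans xe _; rewrite -natrX ler_nat -mulnn leq_mul2r me orbT.
  by rewrite expr_ge1 // ltW // (lt_le_trans ltr01).
have lx0 : 0 <= ln x by rewrite ln_ge0.
have lfact : e%:R * ln e%:R <= 2 * ln (e`!%:R : R).
  rewrite !mulr_natl -!lnXn ?ltr0n ?fact_gt0 // ler_ln ?posrE ?exprn_gt0 ?ltr0n ?fact_gt0 //.
  by rewrite -!natrX ler_nat expn_le_fact_sqr.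
rewrite powR2E -[leRHS]lnK ?posrE ?ltr0n ?fact_gt0 // ler_expR.
have l2 := ln2_le1; have l20 := ln2_gt0.
have r1 : 1 <= r%:R :> R by rewrite ler1n.
have mR : 1 <= m%:R :> R by rewrite ler1n.
rewrite ln_root.
apply: (@le_trans _ _ ((128 * m * r)%:R^-1 * (x * (r%:R * ln x)))).
  by rewrite ler_piMr // mulr_ge0 ?invr_ge0 // mulr_ge0 // mulr_ge0.
rewrite mulrC ler_pdivrMr ?ltr0n ?muln_gt0 ?m0 ?r0 //.
apply: (@le_trans _ _ ((32 * m * e)%:R * (r%:R * (2 * ln e%:R)))).
  by rewrite ler_pM // ?mulr_ge0 // ler_pM2l ?ltr0n.
rewrite !natrM.
apply: (@le_trans _ _ (64 * m%:R * r%:R * (e%:R * ln e%:R))).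
  by rewrite le_eqVlt; apply/orP; left; apply/eqP; ring.
apply: (@le_trans _ _ (64 * m%:R * r%:R * (2 * ln (e`!%:R : R)))).
  by rewrite ler_wpM2l // !mulr_ge0.
by rewrite le_eqVlt; apply/orP; left; apply/eqP; ring.
Qed.

(** Since [d.+1 <= 2 * x], the exponent of [K] is at most [10 * m * h * x]. The successors keep the
    constant positive even for [h = 0]; dividing by [ln 2] changes the base to 2. *)
Lemma expn_le_powR2 m d h (S : nat) : (d ^ r <= K)%N ->
    (S <= (K ^ (5 * (m * d.+1))) ^ h)%N ->
  S%:R <= 2 `^ ((10 * m.+1 * h.+1)%:R / ln 2 * (x * ln K%:R)).
Proof.
move=> dK SK; have x1 := root_ge1; have x0 := root_ge0.
have l20 := ln2_gt0; have KR : 1 <= K%:R :> R by rewrite ler1n.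
have lK0 : 0 <= ln (K%:R : R) by rewrite ln_ge0.
apply: (@le_trans _ _ (K ^ (5 * (m * d.+1) * h))%:R); first by rewrite ler_nat expnM.
rewrite powR2E natrX -[K%:R in leLHS]lnK ?posrE ?ltr0n // -expRM_natl ler_expR.
have -> : (10 * m.+1 * h.+1)%:R / ln 2 * (x * ln K%:R) * ln 2 = (10 * m.+1 * h.+1)%:R * x * ln K%:R.
  by field; rewrite gt_eqF.
rewrite ler_wpM2r //.
have dx : d.+1%:R <= 2 * x by rewrite -natr1 mulr_natl mulr2n lerD ?le_root.
apply: (@le_trans _ _ ((5 * m * h)%:R * (2 * x))).
  by rewrite (_ : 5 * (m * d.+1) * h = 5 * m * h * d.+1)%N ?natrM ?ler_wpM2l // ?mulr_ge0 //; lia.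
rewrite mulrA ler_wpM2r // -natrM ler_nat; nia.
Qed.

End Asymptotics.

Local Open Scope ring_scope.

(** The sizes [n] range over a set [N] because a prime is not a product of two or more arities
    exceeding 8; the predicate that always holds gives the unrestricted form. The base of the
    logarithm is absorbed by [c]. *)
Theorem theorem1p2 (R : realType) (m r h : nat) (k : 'I_h -> nat -> nat)
    (N : nat -> Prop)
    (hm : (6 <= m)%N) (hr : size (primes m) = r) (r2 : (2 <= r)%N)
    (hk : forall n, N n -> (\prod_(i < h) k i n)%N = n)
    (k8 : exists n0, forall n, N n -> (n0 <= n)%N -> forall i, (8 < k i n)%N) :
  let kmax n := (\max_(i < h) k i n)%N in
  let bound (c : R) n :=
    2 `^ (c * ((kmax n)%:R `^ r%:R^-1 * ln (kmax n)%:R)) in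
  (exists2 c : R, 0 < c &
     exists n0, forall n (Nn : N n), (n0 <= n)%N ->
       forall C : circuit m n,
         symmetric_circuit (tree_aut_group (hk n Nn)) C ->
         computes_AND C ->
         bound c n <= (circuit_size C)%:R) /\
  (exists2 c : R, 0 < c &
     exists n0, forall n, N n -> (n0 <= n)%N ->
       exists C : circuit m n,
         [/\ is_depth C (2 * h), computes_AND C &
             (circuit_size C)%:R <= bound c n]).
Proof.
move=> kmax bound; have m0 : (0 < m)%N by apply: leq_trans hm.
have m1 : (1 < m)%N by apply: leq_trans hm.
have r0 : (0 < r)%N by apply: leq_trans r2.
split.
  exists (128 * m * r)%:R^-1; first by rewrite invr_gt0 ltr0n !muln_gt0 m0 r0.
  pose K0 := (4 * m * (128 * m) ^ r)%N.
  (* A product of [h] arities above [K0 ^ h] has a factor above [K0], which is what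
     [lower_parameter] needs. *)
  exists (K0 ^ h).+1 => n Nn nn C Csym CAND.
  have n0 : (0 < n)%N by apply: leq_trans nn.
  have KK : (K0 < kmax n)%N by apply: kmax_gt; rewrite hk.
  have h0 : (0 < #|'I_h|)%N.
    rewrite card_ord; case: (posnP h) KK => // h0.
    by rewrite /kmax big1 // => i; have := ltn_ord i; rewrite {2}h0.
  have [j0 jE] : {j0 | kmax n = k j0 n} by apply: bigop.eq_bigmax.
  have [e [me ee ed Ke]] := lower_parameter m0 r2 (ltnW KK).
  rewrite /bound; apply: le_trans (powR2_le_fact R r0 (leq_trans _ KK) m0 me Ke) _ => //.
  rewrite ler_nat; have e0 : (0 < e)%N by apply: leq_trans me; rewrite muln_gt0.
  apply: (@fact_le_tree_symmetric m n h (k^~ n) (hk n Nn) j0 C (4 * e) e) => //.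
  - by rewrite muln_gt0.
  - by rewrite -jE.
  - by rewrite -jE hr.
exists ((10 * m.+1 * h.+1)%:R / ln 2).
  by rewrite divr_gt0 ?ltr0n ?ln2_gt0.
exists (m ^ h).+1 => n Nn nn.
have n0 : (0 < n)%N by apply: leq_trans nn.
have mK : (m < kmax n)%N by apply: kmax_gt; rewrite hk.
have K0 : (0 < kmax n)%N by apply: leq_trans mK.
have [d [Kd dK]] := upper_parameter r0 K0.
have kK i : (0 < k i n <= kmax n)%N.
  by rewrite (arity_gt0 (hk n Nn)) //= /kmax (leq_bigmax i).
rewrite -hr in Kd.
have := @AND_circuit m d.+1 (kmax n) _ h (k^~ n) _ isT Kd kK (leqnn _).
rewrite hr (hk n Nn) => /(_ r2)[C [Cd CA CS]]; exists C; split=> //.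
apply: (expn_le_powR2 R r0 K0 dK); apply: leq_trans CS _.
(* For [h = 0] both powers are 1; otherwise the bases are compared. *)
have [->//|h0] := posnP h.
by rewrite leq_exp2r //; apply: upper_size => //; apply: ltnW.
Qed.
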